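(* Let $\Lambda$ be any finite simple graph. Then there exists a finite simple graph $\Gamma = \Gamma(\Lambda)$ such that (1) $A_\Lambda \cong \mathrm{PSO}(A_\Gamma)$, and (2) $\mathrm{PSO}(A_\Gamma)$ has finite index in $\mathrm{Out}(A_\Gamma)$. In particular, every right-angled Artin group is (isomorphic to) a finite-index subgroup of the outer automorphism group of some right-angled Artin group.
   Context: All graphs are finite, undirected, without loops or multiple edges. For a graph $\Gamma$ with vertex set $V(\Gamma)$ and edge set $E(\Gamma)$, the right-angled Artin group is $A_\Gamma = \langle V(\Gamma) \mid [v,w]=1 \text{ for } \{v,w\}\in E(\Gamma)\rangle$ (for the graph with no vertices, $A_\emptyset$ is the trivial group). An automorphism $\phi$ of $A_\Gamma$ is pure symmetric if for every vertex $v\in V(\Gamma)$, $\phi(v)$ is a conjugate of $v$ (the conjugating element may depend on $v$); these form a subgroup $\mathrm{PSA}(A_\Gamma)\le \mathrm{Aut}(A_\Gamma)$. The group of pure symmetric outer automorphisms $\mathrm{PSO}(A_\Gamma)$ is the image of $\mathrm{PSA}(A_\Gamma)$ in $\mathrm{Out}(A_\Gamma)=\mathrm{Aut}(A_\Gamma)/\mathrm{Inn}(A_\Gamma)$. *)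

(* Defs.v *)
From mathcomp Require Import all_boot.
From Stdlib Require Import Relations.
Set Implicit Arguments. Unset Strict Implicit. Unset Printing Implicit Defensive.

(* A finite simple graph is a finType V with a symmetric irreflexive rel e. *)

(* Words over the generators V and their inverses: (v,false) = v, (v,true) = v^-1. *)
Definition word (V : Type) := seq (V * bool).

Definition gen (V : Type) (v : V) : word V := [:: (v, false)].

Definition inv_word (V : Type) (w : word V) : word V :=
  rev (map (fun x => (x.1, ~~ x.2)) w).

Inductive raag_step (V : Type) (e : rel V) : word V -> word V -> Prop :=
| step_free u w v b :
    raag_step e (u ++ [:: (v, b); (v, ~~ b)] ++ w) (u ++ w)
| step_comm u w v1 b1 v2 b2 : e v1 v2 ->
    raag_step e (u ++ [:: (v1, b1); (v2, b2)] ++ w)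
                (u ++ [:: (v2, b2); (v1, b1)] ++ w).

Definition raag_eq (V : Type) (e : rel V) : relation (word V) :=
  clos_refl_sym_trans _ (raag_step e).

(* An endomorphism of A_Gamma is given by the images of the generators;
   subst g extends it to words. *)
Definition subst (W : Type) (g : W -> word W) (w : word W) : word W :=
  flatten (map (fun x => if x.2 then inv_word (g x.1) else g x.1) w).

(* g defines an endomorphism of A_f iff it respects the defining relations. *)
Definition is_endo (W : Type) (f : rel W) (g : W -> word W) : Prop :=
  forall v w, f v w -> raag_eq f (g v ++ g w) (g w ++ g v).

Definition aut_comp (W : Type) (g h : W -> word W) : W -> word W :=
  fun v => subst g (h v).

Definition is_auto (W : Type) (f : rel W) (g : W -> word W) : Prop :=
  is_endo f g /\
  exists h, is_endo f h /\
    forall v, raag_eq f (subst g (h v)) (gen v) /\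
              raag_eq f (subst h (g v)) (gen v).

Definition conj_by (W : Type) (c w : word W) : word W := inv_word c ++ w ++ c.

Definition is_PSA (W : Type) (f : rel W) (g : W -> word W) : Prop :=
  is_auto f g /\ forall v, exists c, raag_eq f (g v) (conj_by c (gen v)).

Definition out_eq (W : Type) (f : rel W) (g h : W -> word W) : Prop :=
  exists c, forall v, raag_eq f (g v) (conj_by c (h v)).

(* Main.v *)
(* The given graph is embedded in a larger one in which every vertex v of the former
   is joined to an independent set T, and T separates a subgraph K from the rest.
   Conjugating K by an element of the given group and fixing the other vertices defines
   the isomorphism onto the pure symmetric outer automorphisms.

   Surjectivity: a pure symmetric automorphism sends x to a conjugate of x whose set
   of conjugators is a coset of <star x>, and cosets of adjacent vertices meet. If no
   two stars cover a set M of vertices, and no star separates M, these cosets have a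
   common point for x in M. This applies to the complement of K and to the union
   of K and T, and the two common points differ by an element centralizing T.

   Finite index: no vertex of the larger graph is dominated by another. Comparing the
   ranks of centralizers in the abelianization shows that an automorphism acts there
   by a signed permutation s of the vertices, and then an element representing s(x)
   that commutes with elements representing s(y), for all y adjacent to x, must be
   conjugate to s(x) or its inverse. *)

From Stdlib Require Import Relations Setoid Morphisms.
Require Import Defs.
From mathcomp Require Import all_boot all_fingroup all_algebra zify.

Set Implicit Arguments. Unset Strict Implicit. Unset Printing Implicit Defensive.

Import GRing.Theory.

(** * Signed permutation matrices *)

Section SignedPermutation.
Local Open Scope ring_scope.
Variables (F : fieldType) (n : nat) (st : rel 'I_n) (N : 'M[F]_n).
Hypotheses (st_refl : reflexive st)
  (undominated : forall i j, (forall k, st i k -> k != i -> st j k) -> i = j)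
  (N_unit : N \in unitmx)
  (N_commute : forall i p q r, st i p -> ~~ st q r -> N i q * N p r = N p q * N i r).

(** A nonzero determinant has a nonzero term in its Leibniz expansion. *)
Lemma unitmx_transversal : exists s : 'S_n, forall i, N i (s i) != 0.
Proof.
case: (boolP [exists s : 'S_n, [forall i, N i (s i) != 0]]).
  by case/existsP=> s /forallP h; exists s.
rewrite negb_exists => /forallP h; move: N_unit; rewrite unitmxE /determinant.
rewrite big1 ?unitr0 // => s _; have := h s; rewrite negb_forall => /existsP[i].
by rewrite negbK => /eqP e; rewrite (bigD1 i) //= e mul0r mulr0.
Qed.

(** Projection onto the coordinates in the star of [i]; its rank is the size of that star. *)
Let D i : 'M[F]_n := diag_mx (\row_j (st i j)%:R).

Let mulDmx i (A : 'M[F]_n) p q : (D i *m A) p q = (st i p)%:R * A p q.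
Proof. by rewrite /D mul_diag_mx !mxE. Qed.

Let mulmxD j (A : 'M[F]_n) p q : (A *m D j) p q = A p q * (st j q)%:R.
Proof. by rewrite /D mul_mx_diag !mxE. Qed.

(* A row commuting with row [i] is determined by its entries in the star of [j],
   the other entries being multiples of the [j]-th one. *)
Let rank_starP i j : N i j != 0 ->
  (\rank (D i) <= \rank (D j) ?= iff (D j <= D i *m N *m D j)%MS)%N.
Proof.
move=> nz.
pose K : 'M[F]_n := \matrix_(p, q)
  (if st j q then (p == q)%:R else (p == j)%:R * (N i q / N i j)).
have DN : D i *m N = D i *m N *m D j *m K.
  apply/matrixP => p q; rewrite -!mulmxA !mulDmx.
  case sip: (st i p); last by rewrite !mul0r.
  rewrite !mul1r mulmxA mxE; case sjq: (st j q).
    rewrite (bigD1 q) //= big1 => [|r nr]; rewrite mulmxD !mxE sjq.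
      by rewrite eqxx !mulr1 addr0.
    by rewrite (negPf nr) !mulr0.
  rewrite (bigD1 j) //= big1 => [|r nr]; rewrite mulmxD !mxE sjq.
    rewrite st_refl eqxx mulr1 mul1r addr0 mulrA -(@N_commute i p j q) ?sjq //.
    by rewrite mulrAC divff // mul1r.
  by rewrite (negPf nr) mul0r !mulr0.
(* Multiplying by the invertible [N] keeps the rank, and by [DN] so does the further cut to the star
   of [j]. *)
have e : \rank (D i) = \rank (D i *m N *m D j).
  have := mxrankMfree (D i) (_ : row_free N); rewrite row_free_unit => <- //.
  apply/eqP; rewrite eqn_leq {1}DN mxrankM_maxl /=.
  by rewrite mxrankM_maxl.
by rewrite e; apply: mxrank_leqif_sup; apply: submxMl.
Qed.

(** Summed over a transversal [s], the inequalities of [rank_starP] compare a total with itself, so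
    all are equalities. If [N i j] is nonzero, this puts every [t] of the star of [s i] other than
    [s i] into the star of [j], and [undominated] applies. *)
Lemma signed_permutation : exists s : 'S_n, forall i j, N i j != 0 -> j = s i.
Proof.
have [s hs] := unitmx_transversal; exists s => i j nz.
have : (\sum_i \rank (D i) == \sum_i \rank (D (s i)))%N.
  by rewrite [X in X == _](reindex_inj (@perm_inj _ s)).
have := leqif_sum (fun i (_ : xpredT i) => rank_starP (hs i)).
case=> _ -> /forallP /(_ i) /= /submxP[Z hZ]; apply/esym.
apply: undominated => t st_t nt; apply: contraT => njt.
(* A combination of the rows in the star of [i] that agrees with the [t]-th unit row on the star of
   [s i]. It still commutes with row [i], which forces [y 0 j] to be both zero and nonzero. *)
pose y := row t (Z *m (D i *m N)).
have yst r : st (s i) r -> y 0 r = (t == r)%:R.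
  move=> sr; rewrite [LHS]mxE; have := congr1 (fun A : 'M[F]_n => A t r) hZ.
  rewrite mulmxA mulmxD sr mulr1 => <-.
  by rewrite !mxE st_t; case: (t == r).
have yN q r : ~~ st q r -> N i q * y 0 r = y 0 q * N i r.
  move=> nqr; rewrite /y !mxE mulr_sumr mulr_suml; apply: eq_bigr => p _.
  rewrite !mulDmx; case sip: (st i p); last by rewrite !mul0r !mulr0 mul0r.
  by rewrite !mul1r mulrCA N_commute // mulrA.
have := yN j t njt; rewrite (yst t) // eqxx mulr1 => e.
suff y0 : y 0 j = 0 by rewrite e y0 mul0r eqxx in nz.
case: (boolP (st (s i) j)) => [sj|nsj].
  by rewrite yst //; case: eqP => // etj; rewrite etj st_refl in njt.
have := yN _ _ nsj; rewrite (yst (s i)) // (negPf nt) mul0r => /eqP.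
by rewrite mulf_eq0 (negPf (hs i)) => /eqP.
Qed.

End SignedPermutation.

(** * Powers of words and commutation in free monoids *)

Definition pow (T : Type) (x : seq T) n := iter n (cat x) [::].

Lemma pow_comm (T : Type) (x y : seq T) n :
  x ++ y = y ++ x -> pow x n ++ y = y ++ pow x n.
Proof.
move=> h; elim: n => [|n IH] /=; first by rewrite cats0.
by rewrite -catA IH !catA h.
Qed.

Lemma size_pow (T : Type) (x : seq T) n : size (pow x n) = n * size x.
Proof. by elim: n => //= n IH; rewrite size_cat IH mulSn. Qed.

Lemma count_pow (T : Type) (P : pred T) (x : seq T) n :
  count P (pow x n) = n * count P x.
Proof. by elim: n => //= n IH; rewrite count_cat IH mulSn. Qed.

(** The two powers commute and have the same length, so they are equal prefixes of one word. *)
Lemma commute_pow (T : eqType) (x y : seq T) :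
  x ++ y = y ++ x -> pow x (size y) = pow y (size x).
Proof.
move=> h; have h' := pow_comm (size x) (esym (pow_comm (size y) h)).
move/eqP: h'; rewrite eqseq_cat ?size_pow 1?mulnC // => /andP[/eqP e _].
by rewrite e.
Qed.

(** * Words modulo the relations *)

#[global] Instance raag_eq_equiv (V : Type) (e : rel V) : Equivalence (raag_eq e).
Proof.
split=> [x|x y|x y z]; [exact: rst_refl|exact: rst_sym|exact: rst_trans].
Qed.

#[global] Hint Extern 0 (raag_eq _ _ _) => solve [apply: rst_refl] : core.

Lemma raag_eq_homo (V V' : Type) (e : rel V) (e' : rel V') (h : word V -> word V') :
  (forall x y, raag_step e x y -> raag_eq e' (h x) (h y)) ->
  forall x y, raag_eq e x y -> raag_eq e' (h x) (h y).
Proof.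
move=> hs x y; elim=> [? ? /hs //|?|? ? _ ->|? ? ? _ -> _ ->] //; reflexivity.
Qed.

#[global] Instance cat_raag_eq (V : Type) (e : rel V) :
  Proper (raag_eq e ==> raag_eq e ==> raag_eq e) (@cat (V * bool)).
Proof.
move=> x x' hx y y' hy; transitivity (x ++ y').
  apply: (raag_eq_homo (h := fun z => x ++ z)) hy => u v [p q w b|p q v1 b1 v2 b2 h];
  by apply: rst_step; rewrite !(catA x); first [exact: step_free|exact: step_comm].
apply: (raag_eq_homo (h := fun z => z ++ y')) hx => u v [p q w b|p q v1 b1 v2 b2 h];
by apply: rst_step; rewrite -!catA; first [exact: step_free|exact: step_comm].
Qed.

#[global] Instance cons_raag_eq (V : Type) (e : rel V) (a : V * bool) :
  Proper (raag_eq e ==> raag_eq e) (cons a).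
Proof. by move=> x y h; rewrite -cat1s h. Qed.

Lemma inv_word_cons (V : Type) (a : V * bool) (w : word V) :
  inv_word (a :: w) = inv_word w ++ [:: (a.1, ~~ a.2)].
Proof. by rewrite /inv_word /= rev_cons cats1. Qed.

Lemma inv_word_cat (V : Type) (x y : word V) :
  inv_word (x ++ y) = inv_word y ++ inv_word x.
Proof. by rewrite /inv_word map_cat rev_cat. Qed.

Lemma inv_wordK (V : Type) (x : word V) : inv_word (inv_word x) = x.
Proof.
rewrite /inv_word map_rev revK -map_comp -[RHS]map_id; apply: eq_map => -[a b] /=.
by rewrite negbK.
Qed.

Lemma cat_invw (V : Type) (e : rel V) (x : word V) : raag_eq e (x ++ inv_word x) [::].
Proof.
elim: x => [|[a b] x IH]; first by reflexivity.
rewrite inv_word_cons -cat1s -catA (catA x) IH.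
by apply: rst_step; apply: (@step_free _ e [::] [::]).
Qed.

Lemma cat_invwK (V : Type) (e : rel V) (x y : word V) :
  raag_eq e (x ++ inv_word x ++ y) y.
Proof. by rewrite catA cat_invw. Qed.

Lemma invw_cat (V : Type) (e : rel V) (x : word V) : raag_eq e (inv_word x ++ x) [::].
Proof. by rewrite -{2}[x]inv_wordK cat_invw. Qed.

Lemma invw_catK (V : Type) (e : rel V) (x y : word V) :
  raag_eq e (inv_word x ++ x ++ y) y.
Proof. by rewrite catA invw_cat. Qed.

#[global] Instance inv_word_raag_eq (V : Type) (e : rel V) :
  Proper (raag_eq e ==> raag_eq e) (@inv_word V).
Proof.
move=> x y h; rewrite -[inv_word x]cats0 -(cat_invw e y) catA -{1}h invw_cat.
by reflexivity.
Qed.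

Lemma cat_injl (V : Type) (e : rel V) (x y z : word V) :
  raag_eq e (x ++ y) (x ++ z) -> raag_eq e y z.
Proof. by move=> h; rewrite -(invw_catK e x y) h invw_catK. Qed.

#[global] Instance conj_by_raag_eq (V : Type) (e : rel V) :
  Proper (raag_eq e ==> raag_eq e ==> raag_eq e) (@conj_by V).
Proof. by move=> x x' hx y y' hy; rewrite /conj_by hx hy. Qed.

Lemma conj_by_cat (V : Type) (x y z : word V) :
  conj_by (x ++ y) z = conj_by y (conj_by x z).
Proof. by rewrite /conj_by inv_word_cat -!catA. Qed.

Lemma conj_byM (V : Type) (e : rel V) (c x y : word V) :
  raag_eq e (conj_by c (x ++ y)) (conj_by c x ++ conj_by c y).
Proof. by rewrite /conj_by -!catA cat_invwK. Qed.

Lemma conj_byK (V : Type) (e : rel V) (c x : word V) :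
  raag_eq e (conj_by (inv_word c) (conj_by c x)) x.
Proof.
rewrite -conj_by_cat /conj_by inv_word_cat inv_wordK -!catA.
by rewrite cat_invwK cat_invw cats0.
Qed.

(** Thus the conjugators producing a given conjugate of [x] form a right coset of the centralizer of
    [x]. *)
Lemma conj_by_eq (V : Type) (e : rel V) (b c x : word V) :
  raag_eq e (conj_by b x) (conj_by c x) <->
  raag_eq e (x ++ (b ++ inv_word c)) ((b ++ inv_word c) ++ x).
Proof.
split=> [h|h].
  apply: (@cat_injl _ e (inv_word b)).
  have : raag_eq e (conj_by b x ++ inv_word c) (conj_by c x ++ inv_word c) by rewrite h.
  rewrite /conj_by -!catA invw_catK => ->.
  by rewrite cat_invw cats0.
apply: (@cat_injl _ e b); rewrite /conj_by !cat_invwK.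
have : raag_eq e (x ++ (b ++ inv_word c) ++ c) ((b ++ inv_word c) ++ x ++ c).
  by rewrite catA h -catA.
by rewrite -!catA invw_cat cats0.
Qed.

(** * Endomorphisms given by the images of the generators *)

Section Subst.
Variables (W : Type) (f : rel W).

Lemma subst_cat (g : W -> word W) (x y : word W) :
  subst g (x ++ y) = subst g x ++ subst g y.
Proof. by rewrite /subst map_cat flatten_cat. Qed.

Lemma subst_inv (g : W -> word W) (x : word W) :
  subst g (inv_word x) = inv_word (subst g x).
Proof.
elim: x => // -[a b] x IH; rewrite inv_word_cons subst_cat IH.
rewrite -[(a, b) :: x]cat1s subst_cat inv_word_cat; congr (_ ++ _).
by rewrite /subst /= !cats0; case: b; rewrite //= inv_wordK.
Qed.

Lemma subst_gen (g : W -> word W) (v : W) : subst g (gen v) = g v.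
Proof. by rewrite /subst /= cats0. Qed.

Lemma subst_conj (g : W -> word W) (c x : word W) :
  subst g (conj_by c x) = conj_by (subst g c) (subst g x).
Proof. by rewrite /conj_by !subst_cat subst_inv. Qed.

Lemma commute_inv (x y : word W) : raag_eq f (x ++ y) (y ++ x) ->
  raag_eq f (x ++ inv_word y) (inv_word y ++ x).
Proof.
by move=> h; apply: (@cat_injl _ f y); rewrite cat_invwK catA -h -catA cat_invw cats0.
Qed.

Lemma subst_eq (g : W -> word W) : is_endo f g ->
  forall x y, raag_eq f x y -> raag_eq f (subst g x) (subst g y).
Proof.
move=> eg; apply: raag_eq_homo => _ _ [p q v b|p q v1 b1 v2 b2 h]; rewrite !subst_cat.
  suff -> : raag_eq f (subst g [:: (v, b); (v, ~~ b)]) [::] by [].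
  rewrite /subst /= cats0; case: b => /=; [exact: invw_cat|exact: cat_invw].
suff -> : raag_eq f (subst g [:: (v1, b1); (v2, b2)]) (subst g [:: (v2, b2); (v1, b1)]) by [].
rewrite /subst /= !cats0.
have e12 := eg _ _ h; have e12' := commute_inv e12.
have e21 : raag_eq f (inv_word (g v1) ++ g v2) (g v2 ++ inv_word (g v1)).
  by symmetry; apply: commute_inv; symmetry.
by case: b1; case: b2 => //=; apply: commute_inv.
Qed.

Lemma subst_ext (g h : W -> word W) : (forall v, raag_eq f (g v) (h v)) ->
  forall x, raag_eq f (subst g x) (subst h x).
Proof.
move=> gh; elim=> [|[a b] x IH]; first by reflexivity.
rewrite -cat1s !subst_cat IH /subst /= !cats0.
by case: b; rewrite gh.
Qed.

Lemma subst_id (x : word W) : subst (@gen W) x = x.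
Proof. by elim: x => // -[a []] x IH; rewrite -cat1s subst_cat IH. Qed.

Lemma subst_comp (g h : W -> word W) (x : word W) :
  subst g (subst h x) = subst (aut_comp g h) x.
Proof.
elim: x => // -[a b] x IH; rewrite -cat1s !subst_cat IH; congr (_ ++ _).
by rewrite /subst /= !cats0 -!/(subst _ _); case: b; rewrite // subst_inv.
Qed.

End Subst.

(** * Traces and reduced words *)

Definition inv_letter (W : Type) (a : W * bool) : W * bool := (a.1, ~~ a.2).

Lemma inv_letterK (W : Type) : involutive (@inv_letter W).
Proof. by case=> a b; rewrite /inv_letter /= negbK. Qed.

Section RAAG.
Variables (W : finType) (f : rel W).
Hypotheses (fsym : symmetric f) (firr : irreflexive f).

Implicit Types (a b : W * bool) (c d w p q x y z : word W) (s t : W).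

Definition pair_proj s t w := [seq l <- w | (l.1 == s) || (l.1 == t)].

(* Equality in the trace monoid: by the projection lemma [teq_raag] below, two
   words with the same projections to all pairs of non-commuting generators
   differ by commutations only. *)
Definition teq w w' := forall s t, ~~ f s t -> pair_proj s t w = pair_proj s t w'.

Lemma teq_refl w : teq w w. Proof. by []. Qed.
Lemma teq_sym w w' : teq w w' -> teq w' w.
Proof. by move=> h s t /h ->. Qed.
Lemma teq_trans w1 w2 w3 : teq w1 w2 -> teq w2 w3 -> teq w1 w3.
Proof. by move=> h h' s t st; rewrite h // h'. Qed.

Lemma teq_cat p p' q q' : teq p p' -> teq q q' -> teq (p ++ q) (p' ++ q').
Proof. by move=> h h' s t st; rewrite /pair_proj !filter_cat -!/(pair_proj _ _ _) h // h'. Qed.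

Lemma teq_cons a q q' : teq q q' -> teq (a :: q) (a :: q').
Proof. exact: (@teq_cat [:: a] [:: a]). Qed.

Lemma teq_cat2l p q q' : teq (p ++ q) (p ++ q') -> teq q q'.
Proof.
move=> h s t st; move: (h s t st); rewrite /pair_proj !filter_cat.
by move/eqP; rewrite eqseq_cat // eqxx => /eqP.
Qed.

Lemma teq_cons2 a q q' : teq (a :: q) (a :: q') -> teq q q'.
Proof. exact: (@teq_cat2l [:: a]). Qed.

Lemma teq_comm a b w : f a.1 b.1 -> teq (a :: b :: w) (b :: a :: w).
Proof.
move=> fab s t st; rewrite /pair_proj /=.
case: (boolP ((a.1 == s) || (a.1 == t))) => // /orP[] /eqP ha;
case: (boolP ((b.1 == s) || (b.1 == t))) => // /orP[] /eqP hb; exfalso.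
- by move: fab; rewrite ha hb firr.
- by move: fab; rewrite ha hb (negPf st).
- by move: fab; rewrite ha hb fsym (negPf st).
- by move: fab; rewrite ha hb firr.
Qed.

Lemma teq_commw a p : all (fun b => f b.1 a.1) p -> teq (p ++ [:: a]) (a :: p).
Proof.
elim: p => //= b p IH /andP[fba /IH h].
by apply: (teq_trans (teq_cons b h)); apply: teq_comm.
Qed.

(** Since [f] is irreflexive, the pair [s = t] is allowed in [teq], which gives the projection to a
    single generator. *)
Lemma teq_mem w w' a : teq w w' -> (a \in w) = (a \in w').
Proof.
move=> h; have := h a.1 a.1; rewrite firr => /(_ isT) e.
have m x : (a \in x) = (a \in pair_proj a.1 a.1 x) by rewrite mem_filter eqxx.
by rewrite m e -m.
Qed.

Lemma teq_perm w w' : teq w w' -> perm_eq w w'.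
Proof.
move=> h; apply/allP => a _ /=.
have := h a.1 a.1; rewrite firr => /(_ isT) e.
have m x : count_mem a x = count_mem a (pair_proj a.1 a.1 x).
  rewrite count_filter; apply: eq_count => l /=.
  by case: eqP => // ->; rewrite eqxx.
by rewrite m e -m.
Qed.

Lemma teq_size w w' : teq w w' -> size w = size w'.
Proof. by move/teq_perm/perm_size. Qed.

(** Succeeds exactly when the trace of [w] can be written with [a] in front, and then returns the
    remainder. *)
Fixpoint rem_first a w : option (word W) :=
  if w is b :: w' then
    if b == a then Some w' else
    if f b.1 a.1 then omap (cons b) (rem_first a w') else None
  else None.

Lemma rem_first_teq a w w' : rem_first a w = Some w' -> teq w (a :: w').
Proof.
elim: w w' => //= b w IH w'; case: eqP => [-> [->] //|_].
case: ifP => // fba; case E: (rem_first a w) => [w1|] //= [<-].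
by apply: (teq_trans (teq_cons b (IH _ E))); apply: teq_comm.
Qed.

(** A letter [d] in front of [b] must commute with [b]: otherwise it would head the projection to
    [d.1] and [b.1]. *)
Lemma isSome_rem_first b w : b \in w ->
  (forall s, ~~ f s b.1 -> ohead (pair_proj s b.1 w) = Some b) ->
  isSome (rem_first b w).
Proof.
elim: w => // d w IH hm hp /=; case: (d =P b) => // nd.
have fdb : f d.1 b.1.
  by apply: contraT => nf; have := hp _ nf; rewrite /pair_proj /= eqxx /= => -[].
rewrite fdb; case: (rem_first b w) IH => //= IH; apply: IH.
  by move: hm; rewrite inE => /orP[/eqP e|//]; case: nd.
move=> s sb; have := hp s sb; rewrite /pair_proj /=; case: ifP => // /orP[] /eqP ed.
- by move: sb; rewrite -ed fdb.
- by move: fdb; rewrite ed firr.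
Qed.

Lemma teq_rem_first a w w' : teq w (a :: w') ->
  exists2 w'', rem_first a w = Some w'' & teq w'' w'.
Proof.
move=> h; case E: (rem_first a w) => [w''|].
  exists w'' => //; apply: (@teq_cons2 a); apply: teq_trans h.
  by apply: teq_sym; apply: rem_first_teq.
suff: isSome (rem_first a w) by rewrite E.
apply: isSome_rem_first => [|s sa]; first by rewrite (teq_mem a h) inE eqxx.
by rewrite h // /pair_proj /= eqxx orbT.
Qed.

Definition first a w := exists w', teq w (a :: w').

Lemma firstP a w : reflect (first a w) (isSome (rem_first a w)).
Proof.
case E: (rem_first a w) => [w'|] /=; constructor.
  by exists w'; apply: rem_first_teq.
by case=> w' /teq_rem_first [w'']; rewrite E.
Qed.

Lemma first_teq a w w' : teq w w' -> first a w -> first a w'.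
Proof. by move=> h [z hz]; exists z; apply: teq_trans hz; apply: teq_sym. Qed.

Lemma rem_first_cat a p q : rem_first a (p ++ q) =
  if rem_first a p is Some p' then Some (p' ++ q)
  else if all (fun b => f b.1 a.1) p then omap (cat p) (rem_first a q) else None.
Proof.
elim: p => [|b p IH] /=; first by case: rem_first.
case: eqP => // _; case: ifP => //= fba; rewrite IH.
case: (rem_first a p) => //=; case: (all _ p) => //=.
by case: (rem_first a q).
Qed.

Lemma first_cat a p q : first a (p ++ q) ->
  first a p \/ all (fun b => f b.1 a.1) p /\ first a q.
Proof.
move/firstP; rewrite rem_first_cat.
case E: (rem_first a p) => [p'|] /=.
  by move=> _; left; exists p'; apply: rem_first_teq.
case: ifP => // hp; case E': (rem_first a q) => [q'|] //= _; right; split=> //.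
by exists q'; apply: rem_first_teq.
Qed.

Lemma first_cons a b w : first a (b :: w) -> a = b \/ f b.1 a.1 /\ first a w.
Proof.
move/firstP => /=; case: eqP => [->|_]; first by left.
case: ifP => // fba h; right; split=> //; apply/firstP.
by case: (rem_first a w) h.
Qed.

Lemma first_comm a b w : f b.1 a.1 -> first a (b :: w) -> first a w.
Proof. by move=> fba /first_cons[e|[]//]; move: fba; rewrite e firr. Qed.

Lemma comm_first a b w : f b.1 a.1 -> first a w -> first a (b :: w).
Proof.
move=> fba [z hz]; exists (b :: z); apply: (teq_trans (teq_cons b hz)).
exact: teq_comm.
Qed.

(** * Reduced words and normal forms *)

Definition reduced w := forall p a q, ~ teq w (p ++ a :: inv_letter a :: q).

Lemma reduced_teq w w' : teq w w' -> reduced w -> reduced w'.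
Proof. by move=> h r p a q h'; apply: (r p a q); apply: teq_trans h'. Qed.

Lemma reduced_catl p q : reduced (p ++ q) -> reduced p.
Proof.
move=> r p' a q' h; apply: (r p' a (q' ++ q)).
by have := teq_cat h (teq_refl q); rewrite -catA.
Qed.

Lemma reduced_catr p q : reduced (p ++ q) -> reduced q.
Proof.
move=> r p' a q' h; apply: (r (p ++ p') a q').
by rewrite -catA; apply: teq_cat.
Qed.

Lemma reduced_nil : reduced [::].
Proof. by move=> p a q /teq_size; rewrite size_cat /= !addnS. Qed.

(** Locate the leading [a] in a word [p b b^-1 q] with the trace of [a :: w]. If it comes from [p]
    or [q], deleting it leaves a cancelling pair in [w]; if it is [b], then [inv_letter a] can be
    moved to the front of [w]. *)
Lemma reduced_cons a w : reduced w -> ~ first (inv_letter a) w -> reduced (a :: w).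
Proof.
move=> rw nf p b q h.
have fa : first a (p ++ b :: inv_letter b :: q).
  by exists w; apply: teq_sym.
have cut z : teq (p ++ b :: inv_letter b :: q) (a :: z) -> teq w z.
  by move=> h'; apply: (@teq_cons2 a); apply: teq_trans h'.
case: (first_cat fa) => [[p' hp']|[hp [q' hq']]].
  by apply: (rw p' b q); apply: cut; apply: (teq_cat hp').
have move_p z : teq (p ++ a :: z) (a :: p ++ z).
  by have := teq_cat (teq_commw hp) (teq_refl z); rewrite -catA.
have fq : first a (b :: inv_letter b :: q) by exists q'.
case: (first_cons fq) => [e|[fba fq2]].
  apply: nf; subst b; exists (p ++ q).
  apply: (@teq_trans _ (p ++ inv_letter a :: q)); first exact: cut.
  have := teq_cat (@teq_commw (inv_letter a) p hp) (teq_refl q).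
  by rewrite -catA.
have [q2 hq2] := first_comm (fba : f (inv_letter b).1 a.1) fq2.
apply: (rw p b q2); apply: cut.
apply: (@teq_trans _ (p ++ a :: b :: inv_letter b :: q2)); last exact: move_p.
apply: teq_cat => //; apply: (@teq_trans _ (b :: inv_letter b :: a :: q2)).
  by do 2!apply: teq_cons.
apply: (@teq_trans _ (b :: a :: inv_letter b :: q2)); last exact: teq_comm.
by apply: teq_cons; apply: teq_comm.
Qed.

Lemma reduced_consP a w : reduced (a :: w) -> ~ first (inv_letter a) w.
Proof. by move=> r [z hz]; apply: (r [::] a z); apply: teq_cons. Qed.

(** Left multiplication of a reduced trace by a letter; [insK] and [ins_comm] show that it respects
    the defining relations. *)
Definition ins a w := if rem_first (inv_letter a) w is Some w' then w' else a :: w.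

Variant ins_spec a w : word W -> Prop :=
| InsCancel w' : teq w (inv_letter a :: w') -> ins_spec a w w'
| InsCons : ~ first (inv_letter a) w -> ins_spec a w (a :: w).

Lemma insP a w : ins_spec a w (ins a w).
Proof.
rewrite /ins; case E: (rem_first _ w) => [w'|].
  by apply: InsCancel; apply: rem_first_teq.
by apply: InsCons => /firstP; rewrite E.
Qed.

Lemma ins_teq a w w' : teq w w' -> teq (ins a w) (ins a w').
Proof.
move=> h; case: insP => [z hz|n]; case: insP => [z' hz'|n'].
- apply: (@teq_cons2 (inv_letter a)); apply: teq_trans hz'.
  by apply: teq_trans h; apply: teq_sym.
- by case: n'; exists z; apply: teq_trans hz; apply: teq_sym.
- by case: n; exists z'; apply: teq_trans hz'.
- exact: teq_cons.
Qed.

Lemma ins_reduced a w : reduced w -> reduced (ins a w).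
Proof.
move=> rw; case: insP => [z hz|n]; last exact: reduced_cons.
by apply: (@reduced_catr [:: inv_letter a]); apply: reduced_teq rw.
Qed.

Lemma ins_cancel a w w' : teq w (inv_letter a :: w') -> teq (ins a w) w'.
Proof.
move=> h; case: insP => [z hz|[]]; last by exists w'.
by apply: (@teq_cons2 (inv_letter a)); apply: teq_trans h; apply: teq_sym.
Qed.

Lemma ins_cons a w : ~ first (inv_letter a) w -> ins a w = a :: w.
Proof. by move=> n; case: insP => // z hz; case: n; exists z. Qed.

Lemma insK a w : reduced w -> teq (ins a (ins (inv_letter a) w)) w.
Proof.
move=> rw; case: (insP (inv_letter a) w) => [w'|n]; last exact: ins_cancel.
rewrite inv_letterK => h; rewrite ins_cons; first exact: teq_sym.
by apply: reduced_consP; apply: reduced_teq rw.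
Qed.

Lemma ins_comm_cons a b w : f a.1 b.1 ->
  teq (ins a (b :: w)) (b :: ins a w).
Proof.
move=> fab; case: (insP a w) => [z hz|n].
  apply: ins_cancel; apply: (teq_trans (teq_cons b hz)); apply: teq_comm.
  by rewrite fsym.
rewrite ins_cons; first exact: teq_comm.
by apply: contra_not n; apply: first_comm; rewrite fsym.
Qed.

Lemma ins_comm a b w : f a.1 b.1 -> teq (ins a (ins b w)) (ins b (ins a w)).
Proof.
move=> fab; case: (insP b w) => [w' hw|n].
  apply: teq_sym; apply: ins_cancel; apply: (teq_trans (ins_teq a hw)).
  exact: ins_comm_cons.
apply: (teq_trans (ins_comm_cons _ fab)); rewrite (@ins_cons b) //.
case: (insP a w) => [z hz|_]; apply: contra_not n.
  move=> h; apply: (first_teq (teq_sym hz)); exact: comm_first.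
by move=> h; apply: first_comm h.
Qed.

(** A reduced form, unique up to [teq] by [red_eq]. *)
Definition red w := foldr ins [::] w.

Lemma red_reduced w : reduced (red w).
Proof. by elim: w => [|a w IH] /=; [exact: reduced_nil|exact: ins_reduced]. Qed.

Lemma red_id w : reduced w -> red w = w.
Proof.
elim: w => //= a w IH r; have rw := @reduced_catr [:: a] w r.
by rewrite IH // ins_cons //; apply: reduced_consP.
Qed.

Lemma foldr_ins_teq p x y : teq x y -> teq (foldr ins x p) (foldr ins y p).
Proof. by move=> h; elim: p => //= a p IH; apply: ins_teq. Qed.

Lemma red_step w w' : raag_step f w w' -> teq (red w) (red w').
Proof.
case=> [u z v b|u z v1 b1 v2 b2 h]; rewrite /red !foldr_cat; apply: foldr_ins_teq.
  by apply: (@insK (v, b)); apply: red_reduced.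
exact: ins_comm.
Qed.

Lemma red_eq w w' : raag_eq f w w' -> teq (red w) (red w').
Proof.
elim=> [x y /red_step //|x|x y _|x y z _ h _]; first exact: teq_refl.
  exact: teq_sym.
exact: teq_trans h.
Qed.

Lemma commute_letter a p : all (fun b => f b.1 a.1) p ->
  raag_eq f (p ++ [:: a]) (a :: p).
Proof.
elim: p => //= -[v1 b1] p IH /andP[fba /IH h].
rewrite -cat1s h; apply: rst_step; case: a fba {h IH} => v2 b2 fba.
exact: (@step_comm _ f [::] p).
Qed.

(** By induction: the first letter of [w] occurs in [w'] behind letters that commute with it, so it
    can be moved to the front. *)
Lemma teq_raag w w' : teq w w' -> raag_eq f w w'.
Proof.
elim: w w' => [|a w IH] w' h; first by case: w' h => // b w' /teq_size.
have [p [q [hp e]]] : exists p q, all (fun b => f b.1 a.1) p /\ w' = p ++ a :: q.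
  have [z E _] := teq_rem_first (teq_sym h).
  elim: w' z E {h} => //= b w' IH' z; case: eqP => [->|_]; first by exists [::], w'.
  case: ifP => // fba; case E: (rem_first a w') => [z'|] //= _.
  have [p [q [hp ->]]] := IH' _ E.
  by exists (b :: p), q; rewrite /= fba.
have {}h : teq w (p ++ q).
  apply: (@teq_cons2 a); apply: (teq_trans h); rewrite e -cat1s catA.
  by apply: (@teq_cat _ (a :: p)); first exact: teq_commw.
by rewrite e -(cat1s a w) (IH _ h) -(cat1s a q) (catA p) commute_letter.
Qed.

Lemma red_raag w : raag_eq f w (red w).
Proof.
elim: w => //= a w IH; rewrite -cat1s {1}IH.
case: insP => // z hz; rewrite (teq_raag hz).
by case: a {hz} => v b; apply: rst_step; apply: (@step_free _ f [::] z).
Qed.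

Lemma reduced_eq w w' : reduced w -> reduced w' -> raag_eq f w w' -> teq w w'.
Proof. by move=> r r' /red_eq; rewrite !red_id. Qed.

Lemma size_ins a w : size (ins a w) <= (size w).+1.
Proof. by case: insP => // z /teq_size ->; rewrite ltnW. Qed.

Lemma size_red w : size (red w) <= size w.
Proof. by elim: w => //= a w IH; apply: leq_trans (size_ins _ _) _. Qed.

Lemma size_red_cat p q : size (red (p ++ q)) <= size p + size (red q).
Proof.
elim: p => //= a p IH; apply: leq_trans (size_ins _ _) _; rewrite addSn ltnS.
exact: IH.
Qed.

Lemma size_redE w w' : raag_eq f w w' -> size (red w) = size (red w').
Proof. by move/red_eq/teq_size. Qed.

(** Each cancellation made by [ins] loses length, so [red] keeps the length only if none happens. *)
Lemma size_red_id w : size w <= size (red w) -> reduced w.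
Proof.
elim: w => [_|a w IH /= h]; first exact: reduced_nil.
have rw : reduced w.
  by apply: IH; rewrite -ltnS; apply: leq_trans h _; apply: size_ins.
move: h; rewrite red_id //; case: insP => [z|n _]; last exact: reduced_cons.
by move/teq_size => ->; rewrite /= ltnNge leqW.
Qed.

(** * Retractions onto subgroups generated by vertices, and centralizers of vertices *)

Definition rho (S : pred W) w := [seq l <- w | S l.1].

#[global] Instance rho_raag_eq S : Proper (raag_eq f ==> raag_eq f) (rho S).
Proof.
move=> x y; apply: raag_eq_homo => _ _ [p q v b|p q v1 b1 v2 b2 h];
rewrite /rho !filter_cat /=.
  by case: (S v) => //; apply: rst_step; apply: step_free.
case: (S v1); case: (S v2) => //; by apply: rst_step; apply: step_comm.
Qed.

Lemma rho_cat S x y : rho S (x ++ y) = rho S x ++ rho S y.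
Proof. exact: filter_cat. Qed.

Lemma rho_inv S x : rho S (inv_word x) = inv_word (rho S x).
Proof.
by rewrite /rho /inv_word filter_rev filter_map; congr (rev (map _ _)).
Qed.

Lemma rho_id (S : pred W) x : all (fun l => S l.1) x -> rho S x = x.
Proof. by move/all_filterP. Qed.

(* Membership in the subgroup generated by [S], which is a retract. *)
Definition inS (S : pred W) w := raag_eq f (rho S w) w.

#[global] Instance inS_raag_eq S : Proper (raag_eq f ==> iff) (inS S).
Proof. by move=> x y h; rewrite /inS h. Qed.

Lemma inS_cat S x y : inS S x -> inS S y -> inS S (x ++ y).
Proof. by rewrite /inS rho_cat => -> ->. Qed.

Lemma inS_inv S x : inS S x -> inS S (inv_word x).
Proof. by rewrite /inS rho_inv => ->. Qed.

Lemma inS_rho S x : inS S (rho S x).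
Proof. by rewrite /inS /rho filter_id. Qed.

Lemma all_inS (S : pred W) x : all (fun l => S l.1) x -> inS S x.
Proof. by move/rho_id; rewrite /inS => ->. Qed.

Lemma teq_all (P : pred (W * bool)) x y : teq x y -> all P x = all P y.
Proof. by move/teq_perm/perm_all. Qed.

Lemma red_all (S : pred (W * bool)) x : all S x -> all S (red x).
Proof.
elim: x => //= a x IH /andP[Sa /IH h]; case: insP => [z hz|_] /=; last by rewrite Sa.
by move: h; rewrite (teq_all _ hz) => /andP[].
Qed.

Lemma inS_red (S : pred W) x : inS S x -> all (fun l => S l.1) (red x).
Proof.
move/red_eq => h; rewrite -(teq_all _ h); apply: red_all; exact: filter_all.
Qed.

(** The first letter [a] of a nonempty reduced form would lie in the set [S] chosen to avoid
    [a.1]. *)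
Lemma inS_nil x : (forall s, exists2 S : pred W, ~~ S s & inS S x) -> raag_eq f x [::].
Proof.
move=> h; rewrite (red_raag x); case E: (red x) => [|a z] //.
by have [S nS /inS_red] := h a.1; rewrite E /= (negPf nS).
Qed.

Definition star s : pred W := fun t => (t == s) || f s t.

Lemma star_refl s : star s s. Proof. by rewrite /star eqxx. Qed.

Lemma star_sym s t : star s t = star t s.
Proof. by rewrite /star eq_sym fsym. Qed.

Lemma star_commute s x : inS (star s) x -> raag_eq f (gen s ++ x) (x ++ gen s).
Proof.
suff H y : raag_eq f (gen s ++ rho (star s) y) (rho (star s) y ++ gen s).
  by move=> h; have := H x; rewrite h.
elim: y => [|[t b] y IH] //.
have -> : rho (star s) ((t, b) :: y) =
    if star s t then (t, b) :: rho (star s) y else rho (star s) y by [].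
case: ifP => // h.
have hc : raag_eq f (gen s ++ [:: (t, b)]) ([:: (t, b)] ++ gen s).
  case/orP: h => [/eqP ->|fst]; last by apply: rst_step; apply: (@step_comm _ f [::] [::]).
  case: b => //; transitivity (@nil (W * bool)); first exact: (@cat_invw _ f (gen s)).
  by symmetry; exact: (@invw_cat _ f (gen s)).
transitivity ([:: (t, b)] ++ (gen s ++ rho (star s) y)).
  by rewrite -[(t, b) :: rho _ _]cat1s !catA hc.
by rewrite IH.
Qed.

(** Strip the letters of the star that can be brought to the front of a reduced [x]. Then [s x] and
    [x s] are both reduced, hence equal as traces, so [s] passes through all of [x]; a first letter
    of [x] would then lie in the star. *)
Lemma commute_star s x : raag_eq f (gen s ++ x) (x ++ gen s) -> inS (star s) x.
Proof.
move=> hx; rewrite (red_raag x).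
have {hx} : raag_eq f (gen s ++ red x) (red x ++ gen s) by rewrite -red_raag.
have := @red_reduced x; move: (red x) => {}x.
have [n] := ubnP (size x); elim: n x => // n IH x /ltnSE hn rx hx.
case: (boolP [exists a : W * bool, star s a.1 && isSome (rem_first a x)]).
  case/existsP=> a /andP[sa /firstP[z hz]].
  have rz : reduced z by apply: (@reduced_catr [:: a]); apply: reduced_teq rx.
  rewrite (teq_raag hz) -cat1s; apply: inS_cat; first by apply: all_inS; rewrite /= sa.
  apply: IH => //; first by move: hn; rewrite (teq_size hz).
  have ha : raag_eq f (gen s ++ [:: a]) ([:: a] ++ gen s).
    by apply: star_commute; apply: all_inS; rewrite /= sa.
  have e : raag_eq f x ([:: a] ++ z) by apply: teq_raag.
  by apply: (@cat_injl _ f [:: a]); rewrite catA -ha -catA -e hx e -catA.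
rewrite negb_exists => /forallP nf.
have nf' a : star s a.1 -> ~ first a x.
  by move=> sa fa; have := nf a; rewrite sa; case: firstP.
have rsx : reduced (gen s ++ x).
  by apply: reduced_cons => //; apply: nf'; apply: star_refl.
have rxs : reduced (x ++ gen s).
  by apply: size_red_id; rewrite -(size_redE hx) red_id // !size_cat addnC.
have fs : first (s, false) (x ++ gen s).
  by exists x; apply: teq_sym; apply: reduced_eq.
case: (first_cat fs) => [[z hz]|[hall _]].
  by case: (nf' (s, false)); [apply: star_refl|exists z].
case: x {IH hn rx hx nf rsx rxs fs} hall nf' => [|b x].
  by move=> *; apply: all_inS.
case/andP=> fbs _ nf'.
by case: (nf' b); [rewrite /star fsym fbs orbT|exists x].
Qed.

(** With [d = y x^-1], the conjugate of [t] by [d] commutes with [s], so the retraction onto the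
    star of [s] fixes it and [d] may be replaced by its image there. That image times [x] is the
    common point of the two cosets. *)
Lemma commute_gen_conj s t x y :
  f s t -> raag_eq f (conj_by x (gen s) ++ conj_by y (gen t))
                     (conj_by y (gen t) ++ conj_by x (gen s)) ->
  exists z, inS (star s) (z ++ inv_word x) /\ inS (star t) (z ++ inv_word y).
Proof.
move=> hst h.
pose d := y ++ inv_word x.
have hd : inS (star s) (conj_by d (gen t)).
  apply: commute_star; rewrite /d conj_by_cat.
  rewrite -{1 2}[gen s](conj_byK f x) -!conj_byM.
  by apply: conj_by_raag_eq.
have ht : raag_eq f (conj_by (rho (star s) d) (gen t)) (conj_by d (gen t)).
  transitivity (rho (star s) (conj_by d (gen t))); last exact: hd.
  rewrite /conj_by (rho_cat _ (inv_word d)) (rho_cat _ (gen t)) (rho_inv _ d).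
  have -> : rho (star s) (gen t) = gen t by rewrite /rho /= /star hst orbT.
  by [].
move/conj_by_eq/commute_star: ht => ht.
exists (rho (star s) d ++ x); split.
  by rewrite -catA cat_invw cats0; apply: inS_rho.
by move: ht; rewrite {2}/d inv_word_cat inv_wordK catA.
Qed.

(** * Rigidity of families of conjugators *)

Definition suffix_of c y := exists z, raag_eq f y (z ++ c) /\ reduced (z ++ c).

#[global] Instance suffix_of_raag_eq c : Proper (raag_eq f ==> iff) (suffix_of c).
Proof.
by move=> x y h; split=> -[z [hz r]]; exists z; split; rewrite // ?h // -h.
Qed.

(* For [c] with first letters labelled [s] only, the words ending with [c] form a
   half-space bounded by a hyperplane labelled [s]. *)
Lemma suffix_of_cons c s a y : (forall b, first b c -> b.1 = s) -> a.1 != s ->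
  suffix_of c y -> suffix_of c (a :: y).
Proof.
move=> hc nas [z [hy r]]; case: (firstP (inv_letter a) (z ++ c)) => [h|n]; last first.
  by exists (a :: z); split; [rewrite hy|apply: reduced_cons].
case: (first_cat h) => [[z' hz']|[_ /hc /eqP]]; last by rewrite (negPf nas).
have e : teq (z ++ c) (inv_letter a :: z' ++ c) by apply: (teq_cat hz').
exists z'; split; last first.
  by apply: (@reduced_catr [:: inv_letter a]); apply: reduced_teq r.
rewrite hy (teq_raag e); case: a {h e hz' nas} => v b.
by apply: rst_step; apply: (@step_free _ f [::]).
Qed.

Lemma suffix_of_star c s t x y : (forall b, first b c -> b.1 = s) -> ~~ star t s ->
  inS (star t) x -> suffix_of c y -> suffix_of c (x ++ y).
Proof.
move=> hc nts hx hy; rewrite -hx.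
have : all (fun l => star t l.1) (rho (star t) x) by apply: filter_all.
elim: (rho _ _) => //= a z IH /andP[ta /IH h].
by apply: (suffix_of_cons hc) => //; apply: contraNneq nts => <-.
Qed.

Lemma suffix_of_catr c d y : suffix_of (c ++ d) y -> suffix_of d y.
Proof. by case=> z [hz r]; exists (z ++ c); rewrite -catA. Qed.

(** First letters with a label other than [a.1] commute with [a] and are moved into [z] one by one.
    The remaining suffix bounds a half-space as [suffix_of_cons] requires. *)
Lemma trim_first a q : exists z q', teq (a :: q) (z ++ a :: q') /\
  forall b, first b (a :: q') -> b.1 = a.1.
Proof.
have [n] := ubnP (size q); elim: n q => // n IH q /ltnSE hn.
case: (boolP [exists b : W * bool, (b.1 != a.1) && isSome (rem_first b (a :: q))]).
  case/existsP=> b /andP[nb /firstP /first_cons[e|[fab [q1 hq1]]]].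
    by rewrite e eqxx in nb.
  have [|z [q' [h1 h2]]] := IH q1; first by rewrite (teq_size hq1) in hn.
  exists (b :: z), q'; split=> //; apply: (teq_trans (teq_cons a hq1)).
  by apply: (teq_trans (teq_comm _ fab)); apply: teq_cons.
rewrite negb_exists => /forallP h; exists [::], q; split=> // b hb.
by have := h b; case: firstP => // _; rewrite andbT negbK => /eqP.
Qed.

Lemma size_inv_word x : size (inv_word x) = size x.
Proof. by rewrite /inv_word size_rev size_map. Qed.

Lemma reduced_inv x : reduced x -> reduced (inv_word x).
Proof.
move=> r; apply: size_red_id; rewrite size_inv_word -{1}(red_id r).
rewrite (size_redE (_ : raag_eq f x (inv_word (red (inv_word x))))).
  by apply: leq_trans (size_red _) _; rewrite size_inv_word.
by rewrite -red_raag inv_wordK.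
Qed.

Definition cnt (S : pred W) x := count (fun l => ~~ S l.1) (red x).

Lemma cnt_eq S x y : raag_eq f x y -> cnt S x = cnt S y.
Proof. by move=> /red_eq/teq_perm/seq.permP h; apply: h. Qed.

Lemma cnt_inv S x : cnt S (inv_word x) = cnt S x.
Proof.
rewrite (cnt_eq S (_ : raag_eq f _ (inv_word (red x)))); last by rewrite -red_raag.
rewrite /cnt (red_id (reduced_inv (@red_reduced x))) /inv_word count_rev count_map.
exact: eq_count.
Qed.

(** After inversion the new letter stands in front, where [red] handles it by a single [ins], adding
    or removing a letter of [S]. *)
Lemma cnt_rcons (S : pred W) x a : S a.1 -> cnt S (x ++ [:: a]) = cnt S x.
Proof.
move=> Sa; rewrite -cnt_inv -[RHS]cnt_inv inv_word_cat /cnt /=.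
case: insP => [z /teq_perm/seq.permP -> /=|_ /=];
by rewrite Sa.
Qed.

Lemma cnt0 S x : cnt S x = 0 -> inS S x.
Proof.
move/eqP; rewrite eqn0Ngt -has_count => h; rewrite (red_raag x); apply: all_inS.
by rewrite -[all _ _]negbK -has_predC.
Qed.

(* Think of the right coset <star x>(b x) as a convex set of the Cayley graph. It
   lies on one side of any hyperplane labelled by a letter outside of the star of
   [x], and by connectedness on the same side for all such [x] in [M]. Crossing a
   hyperplane that separates these cosets from 1 decreases the number of letters of
   the [b x] outside of the star of [x]. *)
Lemma rigid (M : pred W) (b : W -> word W) :
  (forall s (D : W -> Prop),
     (forall x y : W, ~~ star s x -> ~~ star s y -> f x y -> D x -> D y) ->
     forall x y : W, M x -> M y -> ~~ star s x -> ~~ star s y -> D x -> D y) ->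
  (forall s t, exists x : W, [/\ M x, ~~ star s x & ~~ star t x]) ->
  (forall x y : W, f x y ->
     raag_eq f (conj_by (b x) (gen x) ++ conj_by (b y) (gen y))
               (conj_by (b y) (gen y) ++ conj_by (b x) (gen x))) ->
  exists p, forall x : W, M x -> inS (star x) (b x ++ inv_word p).
Proof.
move=> conn cover.
have [n] := ubnP (\sum_(x | M x) cnt (star x) (b x)); elim: n b => // n IH b /ltnSE hn comm.
case: (boolP [forall x, M x ==> (cnt (star x) (b x) == 0)]).
  move/forallP => h; exists [::] => x Mx; rewrite cats0; apply: cnt0.
  by apply/eqP; apply: (implyP (h x)).
rewrite negb_forall => /existsP[v]; rewrite negb_imply -lt0n => /andP[Mv].
rewrite -has_count => /hasP[a a_bv nva].
have [p [q def_bv]] : exists p q, red (b v) = p ++ a :: q.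
  by case/splitPr: a_bv => p q; exists p, q.
(* The whole coset of [x] lies in the half-space of the words ending with [c]. *)
pose ends c (x : W) := forall z, inS (star x) z -> suffix_of c (z ++ b x).
have spread c s (hc : forall l, first l c -> l.1 = s) (x y : W) :
    ~~ star s x -> ~~ star s y -> f x y -> ends c x -> ends c y.
  move=> sx sy fxy hx z hz.
  (* Cosets of adjacent vertices share a point, and the coset of [y] does not cross a hyperplane
     labelled [s]. *)
  have [z0 [hz0x hz0y]] := commute_gen_conj fxy (comm _ _ fxy).
  have hz0 : suffix_of c z0.
    by have := hx _ hz0x; rewrite -catA invw_cat cats0.
  have -> : raag_eq f (z ++ b y) ((z ++ inv_word (z0 ++ inv_word (b y))) ++ z0).
    by rewrite inv_word_cat inv_wordK -!catA invw_cat cats0.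
  apply: (suffix_of_star (t := y) hc) => //; first by rewrite star_sym.
  by apply: inS_cat => //; apply: inS_inv.
have [z [q' [hq firsts]]] := trim_first a q.
have av : ~~ star a.1 v by rewrite star_sym.
have ends_v : ends (a :: q') v.
  move=> y hy; apply: (suffix_of_star firsts nva hy).
  have e : teq (red (b v)) ((p ++ z) ++ a :: q').
    by rewrite def_bv -catA; apply: teq_cat.
  exists (p ++ z); split; first by rewrite (red_raag (b v)); apply: teq_raag.
  by apply: (reduced_teq e); apply: red_reduced.
have [c' [l def_c]] : exists c' l, a :: q' = c' ++ [:: l].
  by exists (belast a q'), (last a q'); rewrite cats1 -lastI.
(* Words ending with [c' ++ [:: l]] end with [l], but the hyperplane label changes from [a.1] to
   [l.1]; a vertex outside both stars links the two. *)
have [x0 [Mx0 ax0 lx0]] := cover a.1 l.1.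
have ends_x0 : ends [:: l] x0.
  move=> y hy; apply: (@suffix_of_catr c'); rewrite -def_c.
  by apply: (conn a.1 (ends (a :: q')) (spread _ _ firsts) v).
have ends_l (x : W) : M x -> ~~ star l.1 x -> ends [:: l] x.
  move=> Mx lx; apply: (conn l.1 _ (spread _ _ _) x0) => // l' /first_cons[->//|[_]].
  by case=> ? /teq_size.
(* Crossing the hyperplane of [l]: the count drops by one at each vertex of [M] outside the star of
   [l.1], in particular at [x0], and is unchanged inside that star. *)
pose b' (x : W) := b x ++ [:: inv_letter l].
have cnt_lt (x : W) : M x -> ~~ star l.1 x -> cnt (star x) (b x) = (cnt (star x) (b' x)).+1.
  move=> Mx lx; have [y [hy r]] : suffix_of [:: l] (b x).
    by apply: (ends_l x Mx lx [::]); apply: all_inS.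
  have e : raag_eq f (b' x) y.
    rewrite /b' hy -catA; case: l {lx0 def_c ends_x0 ends_l b' lx hy r} => t o.
    by apply: rst_step; rewrite -[X in raag_step _ _ X]cats0; apply: step_free.
  rewrite (cnt_eq _ hy) (cnt_eq _ e) /cnt (red_id r) (red_id (reduced_catl r)).
  by rewrite count_cat /= star_sym lx addn0 addn1.
have cnt_le (x : W) : M x -> cnt (star x) (b' x) <= cnt (star x) (b x).
  move=> Mx; case: (boolP (star l.1 x)) => [lx|lx]; last by rewrite cnt_lt.
  by rewrite cnt_rcons // star_sym.
have [|x y fxy|p' hp'] := IH b'.
- apply: leq_trans hn; rewrite (bigD1 x0) //= [X in _ < X](bigD1 x0) //= cnt_lt //.
  by rewrite addSn ltnS leq_add2l leq_sum // => x /andP[Mx _]; apply: cnt_le.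
- by rewrite /b' !conj_by_cat -!conj_byM comm.
- exists (p' ++ [:: l]) => x /hp'; rewrite /b' inv_word_cat -catA.
  by rewrite inv_word_cons.
Qed.

(** * Commuting elements *)

Definition expsum (t : W) (w : word W) : int :=
  ((count_mem (t, false) w)%:Z - (count_mem (t, true) w)%:Z)%R.

Lemma expsum_cat t x y : expsum t (x ++ y) = (expsum t x + expsum t y)%R.
Proof. rewrite /expsum !count_cat; lia. Qed.

Lemma expsum_inv t x : expsum t (inv_word x) = (- expsum t x)%R.
Proof.
have h o : count_mem (t, o) (inv_word x) = count_mem (t, ~~ o) x.
  rewrite /inv_word count_rev count_map; apply: eq_count => -[s o'] /=.
  by rewrite !xpair_eqE; case: o; case: o'.
rewrite /expsum !h /=; lia.
Qed.

Lemma expsum_eq t x y : raag_eq f x y -> expsum t x = expsum t y.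
Proof.
elim=> [_ _ []|//|? ? _ ->|? ? ? _ -> _ ->] //.
  move=> p q v b; rewrite !expsum_cat /expsum /= !xpair_eqE.
  by case: b; case: (v == t) => /=; lia.
by move=> p q v1 b1 v2 b2 _; rewrite !expsum_cat /expsum /=; lia.
Qed.

Lemma expsum_conj t c x : expsum t (conj_by c x) = expsum t x.
Proof. rewrite /conj_by !expsum_cat expsum_inv; lia. Qed.

Lemma expsum_gen s t : expsum t (gen s) = (s == t)%:R%R.
Proof. by rewrite /expsum /= !xpair_eqE andbF andbT; case: (s == t). Qed.

Lemma expsum_pair_proj s t x : expsum t (pair_proj s t x) = expsum t x.
Proof.
rewrite /expsum /pair_proj !count_filter.
have h o : count (predI (pred1 (t, o)) (fun l : W * bool => (l.1 == s) || (l.1 == t))) x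
           = count_mem (t, o) x.
  by apply: eq_count => -[l o'] /=; rewrite xpair_eqE; case: (l == t); rewrite ?orbT ?andbT.
by rewrite !h.
Qed.

Lemma reduced_cat_or p q : reduced p -> reduced q -> reduced (p ++ q) \/
  exists a p' q', teq p (p' ++ [:: a]) /\ teq q (inv_letter a :: q').
Proof.
elim: p => [|b p IH] rp rq; first by left.
have rp1 := @reduced_catr [:: b] p rp.
case: (IH rp1 rq) => [r|[a [p' [q' [h1 h2]]]]]; last first.
  by right; exists a, (b :: p'), q'; split=> //; apply: teq_cons.
case: (firstP (inv_letter b) (p ++ q)) => [h|n]; last by left; apply: reduced_cons.
right; case: (first_cat h) => [[p' hp']|[hp [q' hq']]].
  by case: (reduced_consP rp); exists p'.
by exists b, p, q'; split=> //; apply: teq_sym; apply: teq_commw.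
Qed.

(** If [x ++ x] is not reduced, then [x] ends with a letter [a] and begins with its inverse; these
    are distinct occurrences, and removing both by conjugation shortens [x]. *)
Lemma cyclic_reduction w : exists c x, raag_eq f w (conj_by c x) /\ reduced (x ++ x).
Proof.
suff H x : reduced x -> exists c y, raag_eq f x (conj_by c y) /\ reduced (y ++ y).
  by have [c [y [h r]]] := H _ (@red_reduced w); exists c, y; rewrite {1}(red_raag w).
have [n] := ubnP (size x); elim: n x => // n IH x /ltnSE hn r.
case: (reduced_cat_or r r) => [rr|[a [p [q [h1 h2]]]]].
  by exists [::], x; rewrite /conj_by cats0.
have fa : first (inv_letter a) (p ++ [:: a]).
  by exists q; apply: teq_trans h2; apply: teq_sym.
case: (first_cat fa) => [[p' hp']|[_ [q' hq']]]; last first.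
  have := teq_perm hq'; move/perm_mem/(_ a); rewrite !inE eqxx => /esym/orP[/eqP|].
    by case: (a) => ? [] [].
  by case: q' hq' => // ? ? /teq_size.
have h3 : teq x (inv_letter a :: p' ++ [:: a]).
  by apply: (teq_trans h1); apply: (teq_cat hp').
have [||c [y [h4 ry]]] := IH p'.
- by move: hn; rewrite (teq_size h3) /= size_cat addn1 => /ltnW.
- by apply: (@reduced_catl p' [:: a]); apply: (@reduced_catr [:: inv_letter a]);
    apply: reduced_teq r.
exists (c ++ [:: a]), y; split=> //.
by rewrite conj_by_cat -h4 (teq_raag h3).
Qed.

(** A cancelling letter at the junction would either already cancel in [x ++ x] or commute with all
    letters of [x], among which it occurs. *)
Lemma reduced_pow x n : reduced (x ++ x) -> reduced (pow x n).
Proof.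
move=> rx; elim: n => [|n IH] /=; first exact: reduced_nil.
case: n IH => [|n] IH; first by rewrite cats0; apply: reduced_catl rx.
case: (reduced_cat_or (reduced_catl rx) IH) => // -[a [p [q [h1 h2]]]].
have fa : first (inv_letter a) (x ++ pow x n) by exists q.
case: (first_cat fa) => [[p' hp']|[/allP hx _]].
  case: (rx p a p'); apply: (@teq_trans _ ((p ++ [:: a]) ++ x)).
    exact: teq_cat.
  by rewrite -catA; apply: teq_cat => //; apply: teq_cons.
have : a \in x by rewrite (teq_mem a h1) mem_cat inE eqxx orbT.
by move/hx; rewrite firr.
Qed.

Lemma commute_powr x y n : raag_eq f (x ++ y) (y ++ x) ->
  raag_eq f (x ++ pow x n ++ y) ((pow x n ++ y) ++ x).
Proof.
move=> h; elim: n => [|n IH] /=; first by [].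
by rewrite -!catA IH !catA.
Qed.

(* Multiplying [y] by a high power of [x] makes all cancellation between [x] and
   [y] disappear, so that [x] and [y] commute as traces; projecting to the letters
   [s] and [t] then gives commuting words in a free monoid. *)
Lemma commute_support x y t : reduced (x ++ x) -> raag_eq f (x ++ y) (y ++ x) ->
  expsum t x = 0%R -> expsum t y <> 0%R -> all (fun l => f t l.1) x.
Proof.
move=> rx xy ext eyt.
pose L i := size (red (pow x i ++ y)).
have L0 : L 0 <= size y by apply: size_red.
have Llow i : i * size x <= L i + size y.
  rewrite -size_pow -(red_id (@reduced_pow x i rx)).
  rewrite (size_redE (_ : raag_eq f _ (red (pow x i ++ y) ++ inv_word y))).
    by apply: leq_trans (size_red _) _; rewrite size_cat size_inv_word.
  by rewrite -red_raag -catA cat_invw cats0.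
have LS i : L i.+1 <= size x + L i by rewrite /L /= -catA; apply: size_red_cat.
(* If each of the first [2 * size y + 1] steps gained less than [size x], the length would fall
   below the bound [Llow]. *)
have [i hi] : exists i, L i.+1 = size x + L i.
  case: (boolP [exists i : 'I_(2 * size y).+1, L i.+1 == size x + L i]).
    by case/existsP=> i /eqP; exists i.
  rewrite negb_exists => /forallP n; exfalso.
  have bound i : i <= (2 * size y).+1 -> L i + i <= size y + i * size x.
    elim: i => [|i IH] hi; first by rewrite mul0n !addn0.
    have := n (Ordinal hi) => /= ne; have := IH (ltnW hi); have := LS i.
    by move: ne; rewrite mulSn; move: (L i.+1) (L i) (i * size x) => *; lia.
  have := bound _ (leqnn _); have := Llow (2 * size y).+1.
  by move: (L _) (_ * size x) => *; lia.
pose y' := red (pow x i ++ y).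
have xy' : raag_eq f (x ++ y') (y' ++ x).
  by rewrite /y' -red_raag; apply: commute_powr.
have rxy' : reduced (x ++ y').
  apply: size_red_id; rewrite size_cat -/(L i) -hi /L /= -catA.
  by rewrite (size_redE (_ : raag_eq f (x ++ pow x i ++ y) (x ++ y'))) // /y' -red_raag.
have ry'x : reduced (y' ++ x).
  by apply: size_red_id; rewrite -(size_redE xy') (red_id rxy') !size_cat addnC.
have {xy' rxy' ry'x} comm := reduced_eq rxy' ry'x xy'.
have ey' : expsum t y' = expsum t y.
  rewrite /y' -(expsum_eq t (red_raag _)) expsum_cat.
  suff -> : expsum t (pow x i) = 0%R by rewrite GRing.add0r.
  by elim: (i) => //= k; rewrite expsum_cat ext => ->.
apply/allP => l lx; apply: contraT => ntl; case: eyt; rewrite -ey'.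
have nlt : ~~ f l.1 t by rewrite fsym.
(* The projections to [l.1] and [t] commute in a free monoid, so powers of them agree. Comparing
   exponent sums of [t] makes the projection of [x] empty, although it contains [l]. *)
have := comm _ _ nlt; rewrite /pair_proj !filter_cat -!/(pair_proj _ _ _) => /commute_pow e.
have ex_pow k z : expsum t (pow z k) = (k%:Z * expsum t z)%R.
  by rewrite /expsum !count_pow; lia.
have := congr1 (expsum t) e; rewrite !ex_pow !expsum_pair_proj ext GRing.mulr0 => /esym/eqP.
rewrite GRing.mulf_eq0 => /orP[|/eqP //]; rewrite eqz_nat size_eq0 => /eqP e0.
suff : l \in pair_proj l.1 t x by rewrite e0.
by rewrite mem_filter eqxx.
Qed.

(** * Automorphisms of groups without dominated vertices *)

Definition sgn (o : bool) : int := if o then (-1)%R else 1%R.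

Lemma expsum_nil t : expsum t [::] = 0%R. Proof. by []. Qed.

Lemma expsum_cons t a x : expsum t (a :: x) = ((a.1 == t)%:R * sgn a.2 + expsum t x)%R.
Proof.
case: a => s o; rewrite -cat1s expsum_cat; congr (_ + _)%R.
by rewrite /expsum /= !xpair_eqE; case: (s == t); case: o.
Qed.

(* The coefficient of [s t] in the Magnus expansion; it is an invariant of the group
   element when [s] and [t] do not commute. *)
Fixpoint magnus s t (w : word W) : int :=
  if w is a :: w' then ((a.1 == s)%:R * sgn a.2 * expsum t w' + magnus s t w')%R else 0%R.

Lemma magnus_cat s t x y :
  magnus s t (x ++ y) = (magnus s t x + magnus s t y + expsum s x * expsum t y)%R.
Proof.
elim: x => [|a x IH] /=; first by rewrite /expsum /=; lia.
by rewrite IH expsum_cat expsum_cons; lia.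
Qed.

Lemma magnus_eq s t x y : s != t -> ~~ f s t -> raag_eq f x y ->
  magnus s t x = magnus s t y.
Proof.
move=> nst nf; elim=> [_ _ []|//|? ? _ ->|? ? ? _ -> _ ->] //.
  move=> p q v o; rewrite !magnus_cat !expsum_cat /= !expsum_cons !expsum_nil /=.
  case: (v =P s) => [->|_]; rewrite ?(negPf nst) /= ?mulr1n ?mulr0n.
    by case: o => /=; lia.
  by case: (v =P t) => _; case: o => /=; rewrite ?mulr1n ?mulr0n; lia.
move=> p q v1 o1 v2 o2 h; rewrite !magnus_cat !expsum_cat /= !expsum_cons !expsum_nil /=.
have : ~~ ((v1 == s) && (v2 == t)).
  by apply/andP => -[/eqP e1 /eqP e2]; rewrite e1 e2 (negPf nf) in h.
have : ~~ ((v1 == t) && (v2 == s)).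
  by apply/andP => -[/eqP e1 /eqP e2]; rewrite e1 e2 fsym (negPf nf) in h.
by case: (v1 == s); case: (v2 == t); case: (v1 == t); case: (v2 == s) => //= _ _;
  rewrite ?mulr1n ?mulr0n; lia.
Qed.

(** The [s t] coefficients of [x y] and [y x] differ by the difference of the two sides. *)
Lemma commute_expsum s t x y : s != t -> ~~ f s t -> raag_eq f (x ++ y) (y ++ x) ->
  (expsum s x * expsum t y = expsum s y * expsum t x)%R.
Proof. by move=> nst nf /(magnus_eq nst nf); rewrite !magnus_cat; lia. Qed.

Lemma expsum_subst t (g : W -> word W) x :
  expsum t (subst g x) = (\sum_s expsum s x * expsum t (g s))%R.
Proof.
elim: x => [|[v o] x IH]; first by rewrite big1 // => s _; rewrite mul0r.
rewrite -cat1s subst_cat expsum_cat IH.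
under [RHS]eq_bigr do rewrite expsum_cons mulrDl.
rewrite big_split /=; congr (_ + _)%R; rewrite (bigD1 v) //= big1 ?addr0 => [|s ns].
  by rewrite eqxx mul1r /subst /= cats0; case: o; rewrite ?expsum_inv /=; lia.
by rewrite eq_sym (negPf ns) !mul0r.
Qed.

Lemma reduced_single s x : reduced x -> all (fun l => l.1 == s) x ->
  exists o, x = nseq (size x) (s, o).
Proof.
elim: x => [|[t o] x IH] r /=; first by exists false.
case/andP=> /eqP e hx; subst t; have [o' E] := IH (@reduced_catr [:: (s, o)] x r) hx.
case: (o =P o') => [->|no]; first by exists o'; rewrite -E.
case: x {IH hx} E r => [_|b x /= [eb _]] r; first by exists o.
case: (r [::] (s, o) x); rewrite eb /= /inv_letter /=.
by have -> : o' = ~~ o by case: (o) (o') no => [] [].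
Qed.

(** Triviality of the domination relation, link inside star, which governs transvections. *)
Definition undominated := forall s u : W, (forall t, f s t -> star u t) -> s = u.

(** The inverse of [s] is a power of [s]. *)
Lemma perm_homoV (s : {perm W}) : (forall x y : W, f x y -> f (s x) (s y)) ->
  forall x y : W, f (s x) (s y) -> f x y.
Proof.
move=> h x y; have it k (x' y' : W) : f x' y' -> f ((s ^+ k)%g x') ((s ^+ k)%g y').
  elim: k x' y' => [|k IH] x' y' h'; first by rewrite !perm1.
  by rewrite expgS !permM; apply: IH; apply: h.
move/(it #[s]%g.-1); rewrite -!permM -expgS prednK ?order_gt0 // expg_order.
by rewrite !perm1.
Qed.

Lemma auto_signed_perm (g : W -> word W) : undominated -> is_auto f g ->
  exists (s : {perm W}) (o : {ffun W -> bool}),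
    (forall x y : W, f x y -> f (s x) (s y)) /\
    forall x : W, exists c, raag_eq f (g x) (conj_by c [:: (s x, o x)]).
Proof.
move=> undom [endo_g [h [endo_h gh]]].
pose N (g : W -> word W) : 'M[rat]_#|W| :=
  (\matrix_(i, j) (expsum (enum_val j) (g (enum_val i)))%:~R)%R.
have hgs : (forall x y : W, \sum_z expsum z (g x) * expsum y (h z) = (x == y)%:R)%R.
  by move=> x y; case: (gh x) => _ hgx; rewrite -expsum_subst (expsum_eq _ hgx) expsum_gen.
have NNh : (N g *m N h = 1%:M)%R.
  apply/matrixP => i j; rewrite !mxE.
  have -> : ((i == j)%:R = ((enum_val i == enum_val j)%:R : int)%:~R :> rat)%R.
    by rewrite (inj_eq enum_val_inj); case: (i == j).
  rewrite -hgs.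
  rewrite rmorph_sum /= [RHS](reindex_onto (@enum_val W W) enum_rank) /=; last first.
    by move=> x _; rewrite enum_rankK.
  by apply: eq_big => [k|k _]; rewrite ?enum_valK ?eqxx // !mxE rmorphM.
have unitN : (N g \in unitmx)%R by case: (mulmx1_unit NNh).
pose st (i j : 'I_#|W|) := star (enum_val i) (enum_val j).
have [|i j hij||i p q r|s hs] := @signed_permutation rat #|W| st (N g).
- by move=> i; apply: star_refl.
- apply: enum_val_inj; apply: undom => t ft; rewrite -(enum_rankK t); apply: hij.
    by rewrite /st enum_rankK /star ft orbT.
  by apply: contraTneq ft => <-; rewrite enum_rankK firr.
- by [].
- rewrite /st !mxE -!rmorphM /star /= => hip; rewrite negb_or => /andP[nqr fqr].
  congr (_%:~R)%R; apply: commute_expsum; rewrite 1?eq_sym //.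
  case/orP: hip => [/eqP -> //|]; exact: endo_g.
have s_inj : injective (fun x : W => enum_val (s (enum_rank x))).
  by move=> x y /enum_val_inj/perm_inj/enum_rank_inj.
pose sg := perm s_inj.
have ex0 (x y : W) : y != sg x -> expsum y (g x) = 0%R.
  move=> ny; apply: contraNeq ny => nz; rewrite permE -[y]enum_rankK.
  by rewrite (hs (enum_rank x) (enum_rank y)) // mxE !enum_rankK intr_eq0.
have ex1 (x : W) : `|expsum (sg x) (g x)|%N = 1%N.
  (* Only one term of this diagonal entry survives: a product of two integers equal to 1. *)
  have := hgs x x; rewrite eqxx (bigD1 (sg x)) //= big1 ?addr0 => [|z nz].
    by move/(congr1 absz); rewrite abszM => /eqP; rewrite muln_eq1 => /andP[/eqP].
  by rewrite ex0 // mul0r.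
have sg_edge (x y : W) : f x y -> f (sg x) (sg y).
  (* Otherwise [commute_expsum] makes the product of two entries of absolute value 1 vanish. *)
  move=> fxy; apply: contraT => nf.
  have nxy : sg x != sg y.
    by rewrite (inj_eq perm_inj); apply: contraTneq fxy => ->; rewrite firr.
  have := commute_expsum nxy nf (endo_g _ _ fxy).
  rewrite (ex0 y (sg x)) // mul0r => /eqP; rewrite mulf_eq0.
  by move: (ex1 x) (ex1 y) => /eqP hx /eqP hy /orP[]/eqP e; rewrite e in hx hy.
have sg_edgeV := perm_homoV sg_edge.
have conj_gen (x : W) : exists o, exists c, raag_eq f (g x) (conj_by c [:: (sg x, o)]).
  have [c [y [gx ry]]] := cyclic_reduction (g x).
  have ey t : expsum t y = expsum t (g x) by rewrite (expsum_eq t gx) expsum_conj.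
  (* Each neighbour of [sg x] is some [sg z] with [z] adjacent to [x]. By [commute_support] it is
     adjacent to every letter of [y], so [undom] identifies these letters with [sg x]. *)
  have y_single : all (fun l => l.1 == sg x) y.
    apply/allP => l ly; apply/eqP; apply/esym; apply: undom => t ft.
    pose z := (sg^-1)%g t; have et : t = sg z by rewrite /z permKV.
    have fxz : f x z by apply: sg_edgeV; rewrite -et.
    suff /allP/(_ l ly) h1 : all (fun l => f t l.1) y by rewrite /star fsym h1 orbT.
    apply: (@commute_support y (conj_by (inv_word c) (g z))) => //.
    + rewrite -{1}[y](conj_byK f c) -{2}[y](conj_byK f c) -gx -!conj_byM.
      by rewrite endo_g.
    + by rewrite ey ex0 //; apply: contraTneq ft => ->; rewrite firr.
    + by rewrite expsum_conj et => e; have := ex1 z; rewrite e.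
  have [o ho] := reduced_single (reduced_catl ry) y_single; exists o, c.
  suff sy : size y = 1%N by rewrite gx ho sy.
  have := ex1 x; rewrite -ey ho size_nseq /expsum !count_nseq /= !xpair_eqE eqxx.
  by case: (o) => /=; lia.
have [o ho] := fin_all_exists conj_gen.
exists sg, (finfun o); split=> // x; rewrite ffunE; exact: ho.
Qed.

(** * Composition of automorphisms, and signed graph symmetries as coset representatives *)

Lemma aut_comp_endo (g h : W -> word W) :
  is_endo f g -> is_endo f h -> is_endo f (aut_comp g h).
Proof.
by move=> eg eh s t /eh e; rewrite /aut_comp -!subst_cat; apply: subst_eq.
Qed.

Lemma aut_comp_auto (g h : W -> word W) :
  is_auto f g -> is_auto f h -> is_auto f (aut_comp g h).
Proof.
move=> [eg [g' [eg' gg']]] [eh [h' [eh' hh']]]; split; first exact: aut_comp_endo.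
exists (aut_comp h' g'); split=> [|v]; first exact: aut_comp_endo.
have cancel (k k' l l' : W -> word W) : is_endo f k -> is_endo f l' ->
    (forall v : W, raag_eq f (subst k (k' v)) (gen v)) ->
    (forall v : W, raag_eq f (subst l (l' v)) (gen v)) ->
    raag_eq f (subst (aut_comp k l) (aut_comp l' k' v)) (gen v).
  move=> ek el' kk' ll'; rewrite /aut_comp -subst_comp -(kk' v).
  apply: subst_eq => //; rewrite subst_comp -[X in raag_eq f _ X]subst_id.
  exact: subst_ext.
by split; apply: cancel => // w; [case: (gg' w)|case: (hh' w)|case: (hh' w)|case: (gg' w)].
Qed.

Lemma gen_auto : is_auto f (@gen W).
Proof.
have eg : is_endo f (@gen W).
  by move=> s t fst; apply: rst_step; apply: (@step_comm _ f [::] [::]).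
by split=> //; exists (@gen W); split=> // v; rewrite subst_id.
Qed.

Definition signed_perm (s : {perm W}) (o : W -> bool) (v : W) : word W := [:: (s v, o v)].

Lemma signed_permK (s : {perm W}) o v :
  subst (signed_perm s o) (signed_perm s^-1%g (o \o s^-1%g) v) = gen v /\
  subst (signed_perm s^-1%g (o \o s^-1%g)) (signed_perm s o v) = gen v.
Proof.
rewrite /subst /= !cats0 /signed_perm /inv_word /= permK permKV.
by split; [case E: (o _)|case E: (o v)]; rewrite /= ?E.
Qed.

Lemma signed_perm_endo (s : {perm W}) o :
  (forall x y : W, f x y -> f (s x) (s y)) -> is_endo f (signed_perm s o).
Proof.
by move=> h x y /h fxy; apply: rst_step; apply: (@step_comm _ f [::] [::]).
Qed.

Lemma perm_homoV1 (s : {perm W}) : (forall x y : W, f x y -> f (s x) (s y)) ->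
  forall x y : W, f x y -> f (s^-1%g x) (s^-1%g y).
Proof. by move=> h x y fxy; apply: (perm_homoV h); rewrite !permKV. Qed.

(** Composing [g] with the inverse of its signed permutation leaves a pure symmetric automorphism,
    and there are finitely many signed permutations. *)
Lemma PSA_finite_index : undominated ->
  exists (n : nat) (L : 'I_n -> W -> word W), (forall i, is_auto f (L i)) /\
    forall g, is_auto f g ->
      exists i (p : W -> word W), is_PSA f p /\ out_eq f g (aut_comp (L i) p).
Proof.
move=> undom; pose T : finType := ({perm W} * {ffun W -> bool})%type.
pose homo (s : {perm W}) := [forall x, [forall y, f x y ==> f (s x) (s y)]].
pose L (i : 'I_#|T|) : W -> word W :=
  let so := enum_val i in
  (* The identity is a default for permutations that do not preserve edges, so that every [L i] is
     an automorphism. *)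
  if homo so.1 then signed_perm so.1 so.2 else @gen W.
have homoP (s : {perm W}) : reflect (forall x y : W, f x y -> f (s x) (s y)) (homo s).
  apply: (iffP forallP) => h x; last by apply/forallP => y; apply/implyP; apply: h.
  by move=> y; apply/implyP; move/forallP: (h x).
exists #|T|, L; split=> [i|g ag].
  rewrite /L; case: homoP => [h|_]; last exact: gen_auto.
  split; first exact: signed_perm_endo.
  exists (signed_perm (enum_val i).1^-1%g ((enum_val i).2 \o (enum_val i).1^-1%g)).
  split; first by apply: signed_perm_endo; apply: perm_homoV1.
  by move=> v; case: (signed_permK (enum_val i).1 (enum_val i).2 v) => -> ->.
have [s [o [hs ho]]] := auto_signed_perm undom ag.
exists (enum_rank (s, o)); rewrite /L enum_rankK /=; case: homoP => // _.
pose k := signed_perm s o; pose k' := signed_perm s^-1%g (o \o s^-1%g).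
have ek : is_endo f k by apply: signed_perm_endo.
have ek' : is_endo f k' by apply: signed_perm_endo; apply: perm_homoV1.
have kk' v : subst k (k' v) = gen v by case: (signed_permK s o v).
have k'k v : subst k' (k v) = gen v by case: (signed_permK s o v).
exists (aut_comp k' g); split; last first.
  exists [::] => v; rewrite /conj_by cats0 /aut_comp subst_comp.
  by rewrite -{1}[g v]subst_id; apply: subst_ext => w; rewrite /aut_comp kk'.
split=> [|v].
  by apply: aut_comp_auto => //; split=> //; exists k; split=> // v; rewrite kk' k'k.
have [c hc] := ho v; exists (subst k' c).
by rewrite /aut_comp (subst_eq ek' hc) subst_conj -[[:: _]]/(k v) k'k.
Qed.

End RAAG.

(** * The graph *)

Section Construction.
Variables (V : finType) (e : rel V).
Hypotheses (esym : symmetric e) (eirr : irreflexive e).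

(* The [vV v] are the vertices of the given graph, joined to all the [vT i], so that
   removing the star of [vV v] separates the [vK i] from the rest. The [vR v] and the
   [vQ i] exclude dominated vertices and further separating stars. *)
Definition vert : finType := (V + V + ('I_5 + 'I_5 + 'I_5))%type.
Definition vV (v : V) : vert := inl (inl v).
Definition vR (v : V) : vert := inl (inr v).
Definition vT (i : 'I_5) : vert := inr (inl (inl i)).
Definition vK (i : 'I_5) : vert := inr (inl (inr i)).
Definition vQ (i : 'I_5) : vert := inr (inr i).

(** The [vK i] and the [vQ i] form pentagons, each matched with the [vT i]. Two neighbours [vQ 0]
    and [vQ 2] keep [vT 0] from dominating [vR v], and one of them survives when the star of a
    [vT k] is removed. *)
Definition arc (x y : vert) : bool :=
  match x, y with
  | inl (inl v), inl (inl w) => e v w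
  | inl (inl v), inl (inr w) => v == w
  | inl (inl _), inr (inl (inl _)) => true
  | inl (inr _), inr (inr i) => (i == 0 :> nat) || (i == 2 :> nat)
  | inr (inl (inl i)), inr (inl (inr j)) => i == j :> nat
  | inr (inl (inl i)), inr (inr j) => i == j :> nat
  | inr (inl (inr i)), inr (inl (inr j)) => j == i.+1 %% 5 :> nat
  | inr (inr i), inr (inr j) => j == i.+1 %% 5 :> nat
  | _, _ => false
  end.

Definition edge (x y : vert) : bool := arc x y || arc y x.

Lemma edge_sym : symmetric edge.
Proof. by move=> x y; rewrite /edge orbC. Qed.

Lemma edge_irr : irreflexive edge.
Proof.
move=> [[v|v]|[[[i hi]|[i hi]]|[i hi]]] //; rewrite /edge /= ?eirr //;
by move: i hi; do 5!case=> //.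
Qed.

Lemma edgeVV v w : edge (vV v) (vV w) = e v w.
Proof. by rewrite /edge /= (esym w v) orbb. Qed.

Ltac ord_cases i := case: i => [[|[|[|[|[|//]]]]] ?].

(** Equality in a form that computes on constructors, so that stars simplify through [starE]. *)
Definition same (x y : vert) : bool :=
  match x, y with
  | inl (inl v), inl (inl w) => v == w
  | inl (inr v), inl (inr w) => v == w
  | inr (inl (inl i)), inr (inl (inl j)) => i == j :> nat
  | inr (inl (inr i)), inr (inl (inr j)) => i == j :> nat
  | inr (inr i), inr (inr j) => i == j :> nat
  | _, _ => false
  end.

Lemma starE x y : star edge x y = same y x || (arc x y || arc y x).
Proof.
rewrite /star -/(edge x y); congr (_ || _).
by case: y => [[v|v]|[[i|i]|i]]; case: x => [[w|w]|[[j|j]|j]].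
Qed.

Lemma undominated_edge : undominated edge.
Proof.
move=> x y h; have {h} h t : arc x t || arc t x -> same t y || (arc y t || arc t y).
  by rewrite -starE; apply: h.
case: x h => [[v|v]|[[i|i]|i]] h.
- move: (h (vR v)) (h (vT (@Ordinal 5 0 isT))) (h (vT (@Ordinal 5 1 isT))) => /=.
  rewrite eqxx => /(_ isT) h1 /(_ isT) h2 /(_ isT) h3.
  case: y h1 h2 h3 {h} => [[w|w]|[[j|j]|j]] //=; last by ord_cases j.
  by rewrite orbF => /eqP ->.
- move: (h (vV v)) (h (vQ (@Ordinal 5 0 isT))) (h (vQ (@Ordinal 5 2 isT))) => /=.
  rewrite eqxx => /(_ isT) h1 /(_ isT) h2 /(_ isT) h3.
  case: y h1 h2 h3 {h} => [[w|w]|[[j|j]|j]] //=; last by ord_cases j.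
  by move/eqP ->.
- move: (h (vK i)) (h (vQ i)) => /=; rewrite eqxx => /(_ isT) h1 /(_ isT) h2.
  case: y h1 h2 {h} => [[w|w]|[[j|j]|j]] //=.
  by rewrite orbF => /eqP/val_inj ->.
- move: (h (vT i)) (h (vK (ordS i))) (h (vK (ord_pred i))) => /=.
  rewrite !eqxx => /(_ isT) h1 /(_ isT) h2 h3.
  case: y h1 h2 h3 {h} => [[w|w]|[[j|j]|j]] //=; last by move/eqP/val_inj ->.
  by move=> _; ord_cases i; ord_cases j => // _ /(_ isT).
- move: (h (vT i)) (h (vQ (ordS i))) (h (vQ (ord_pred i))) => /=.
  rewrite !eqxx => /(_ isT) h1 /(_ isT) h2 h3.
  case: y h1 h2 h3 {h} => [[w|w]|[[j|j]|j]] //=; last by move/eqP/val_inj ->.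
  by move=> _; ord_cases i; ord_cases j => // _ /(_ isT).
Qed.

(** * Connectivity of complements of stars, as propagation of a predicate along edges *)

Definition propagates (u : vert) (D : vert -> Prop) := forall x y : vert,
  ~~ star edge u x -> ~~ star edge u y -> edge x y -> D x -> D y.

Lemma val_iter_ordS k (i : 'I_5) : iter k (@ordS 5) i = (i + k) %% 5 :> nat.
Proof.
elim: k => [|k /= ->]; first by rewrite addn0 modn_small.
by rewrite -addn1 modnDml addn1 addnS.
Qed.

(** Adding 5 keeps the natural subtraction from truncating. *)
Lemma iter_ordSP (i j : 'I_5) : j = iter (j + 5 - i) (@ordS 5) i.
Proof. by apply: val_inj; rewrite /= val_iter_ordS; ord_cases i; ord_cases j. Qed.

Lemma ordS_neq (i : 'I_5) : ordS i != i.
Proof. by ord_cases i. Qed.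

Lemma cycle5 (P : 'I_5 -> Prop) : (forall i, P i -> P (ordS i)) -> forall i j, P i -> P j.
Proof.
move=> h i j Pi; rewrite (iter_ordSP i j); elim: (_ - _) => //= k; exact: h.
Qed.

(** Removing [o] leaves a path of four vertices starting at [ordS o], the base point. *)
Lemma cycle5_rem (P : 'I_5 -> Prop) (o : 'I_5) :
  (forall i, i != o -> ordS i != o -> (P i <-> P (ordS i))) ->
  forall i j, i != o -> j != o -> P i -> P j.
Proof.
move=> h.
have H k : k < 4 -> P (ordS o) <-> P (iter k (@ordS 5) (ordS o)).
  elim: k => //= k IH hk; rewrite IH ?(ltnW hk) //; apply: h;
  rewrite -val_eqE /= val_iter_ordS /=; clear IH; move: hk;
  by ord_cases o; move: k; do 4!case=> //.
have H' i : i != o -> (P (ordS o) <-> P i).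
  move=> ni; rewrite (iter_ordSP (ordS o) i).
  have -> : iter (i + 5 - ordS o) (@ordS 5) (ordS o) =
            iter ((i + 5 - ordS o) %% 5) (@ordS 5) (ordS o).
    by apply: val_inj; rewrite /= !val_iter_ordS modnDmr.
  apply: H; clear h; move: ni; rewrite -val_eqE /=; ord_cases o; by ord_cases i.
by move=> i j /H' hi /H' hj /hi /hj.
Qed.

Definition isV (x : vert) := if x is inl (inl _) then true else false.
Definition isK (x : vert) := if x is inr (inl (inr _)) then true else false.
Definition isKT (x : vert) := if x is inr (inl _) then true else false.

Section Connectivity.
Variables (u : vert) (D : vert -> Prop).
Hypothesis hD : propagates u D.

Let link x y : ~~ star edge u x -> ~~ star edge u y -> edge x y -> (D x <-> D y).
Proof.
by move=> ux uy xy; split; apply: hD => //; rewrite edge_sym.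
Qed.

Lemma connected_K i j : isV u -> D (vK i) -> D (vK j).
Proof.
case: u link => [[v|v]|[[k|k]|k]] // lk _.
apply: (@cycle5 (D \o vK)) => {}i; apply: iffLR; apply: lk; rewrite ?starE //=.
by rewrite /edge /= eqxx.
Qed.

(** All [vT i] lie in the star of [u]; each remaining [vV w] reaches [vQ 0] through [vR w]. *)
Lemma connected_VRQ x y : isV u -> ~~ star edge u x -> ~~ star edge u y ->
  ~~ isK x -> ~~ isK y -> D x -> D y.
Proof.
case: u link => [[v|v]|[[k|k]|k]] // lk _ ux uy nKx nKy.
have q i j : D (vQ i) -> D (vQ j).
  apply: (@cycle5 (D \o vQ)) => {}i; apply: iffLR; apply: lk; rewrite ?starE //=.
  by rewrite /edge /= eqxx.
pose hub := vQ (@Ordinal 5 0 isT).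
suff H x' : ~~ star edge (inl (inl v)) x' -> ~~ isK x' -> (D x' <-> D hub).
  by move/(H _ ux nKx)/(H _ uy nKy).
have HR w : w != v -> (D (vR w) <-> D hub).
  by move=> nwv; apply: lk; rewrite ?starE //= orbF eq_sym.
case: x' => [[w|w]|[[i|i]|i]]; rewrite starE //= => nv _.
- have nwv : w != v by apply: contraNneq nv => ->; rewrite eqxx.
  rewrite -(HR w nwv); apply: lk; rewrite ?starE //= ?eqxx //.
  + by rewrite orbF eq_sym.
  + by rewrite /edge /= eqxx.
- by apply: HR; move: nv; rewrite orbF eq_sym.
- by split; apply: q.
Qed.

(** The hub lies in a pentagon that misses the star of [u]: that of the [vK i] for [vR v] and
    [vQ k], that of the [vQ i] for [vK k]. For [vT k] it lies on the path left after removing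
    [vQ k]. *)
Lemma connected_all x y : ~~ isV u -> ~~ star edge u x -> ~~ star edge u y -> D x -> D y.
Proof.
move=> nV; suff [hub H] : exists hub, forall z, ~~ star edge u z -> (D z <-> D hub).
  by move=> ux uy /(H _ ux)/(H _ uy).
case: u nV link => [[v|v]|[[k|k]|k]] // _ lk.
- exists (vK (@Ordinal 5 0 isT)).
  have HK i : D (vK i) <-> D (vK (@Ordinal 5 0 isT)).
    split; apply: (@cycle5 (D \o vK)) => {}i; apply: iffLR; apply: lk; rewrite ?starE //=;
    by rewrite /edge /= eqxx.
  have HT i : D (vT i) <-> D (vK (@Ordinal 5 0 isT)).
    by rewrite -(HK i); apply: lk; rewrite ?starE //= /edge /= eqxx.
  have HV w : w != v -> (D (vV w) <-> D (vK (@Ordinal 5 0 isT))).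
    move=> nwv; rewrite -(HT (@Ordinal 5 0 isT)).
    by apply: lk; rewrite ?starE //= eq_sym.
  case=> [[w|w]|[[i|i]|i]] nz.
  + by apply: HV; move: nz; rewrite starE /=.
  + have nwv : w != v by move: nz; rewrite starE /= orbF.
    rewrite -(HV _ nwv); apply: lk => //; rewrite ?starE //=.
    by rewrite /edge /= eqxx.
  + exact: HT.
  + exact: HK.
  + by rewrite -(HT i); apply: lk => //; rewrite ?starE //= /edge /= eqxx.
- exists (vQ (ordS k)).
  have nQ i : ~~ star edge (vT k) (vQ i) = (i != k).
    by rewrite starE /= orbF eq_sym.
  have nK i : ~~ star edge (vT k) (vK i) = (i != k).
    by rewrite starE /= orbF eq_sym.
  have nT i : ~~ star edge (vT k) (vT i) = (i != k).
    by rewrite starE /= orbF.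
  have HQ i : i != k -> (D (vQ i) <-> D (vQ (ordS k))).
    have Q : forall i j, i != k -> j != k -> D (vQ i) -> D (vQ j).
      apply: (@cycle5_rem (D \o vQ)) => {}i ni nSi; apply: lk; rewrite ?nQ //.
      by rewrite /edge /= eqxx.
    by move=> ni; split; apply: Q => //; apply: ordS_neq.
  have HT i : i != k -> (D (vT i) <-> D (vQ (ordS k))).
    move=> ni; rewrite -(HQ i ni); apply: lk; rewrite ?nQ ?nT //.
    by rewrite /edge /= eqxx.
  case=> [[w|w]|[[i|i]|i]] nz.
  + by move: nz; rewrite starE.
  + have [i i02 ni] : exists2 i : 'I_5, (i == 0 :> nat) || (i == 2 :> nat) & i != k.
      case: (boolP (k == 0 :> nat)) => k0.
        by exists (@Ordinal 5 2 isT) => //; rewrite -val_eqE /= (eqP k0).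
      by exists (@Ordinal 5 0 isT) => //; rewrite -val_eqE /= eq_sym.
    rewrite -(HQ i ni); apply: lk; rewrite ?nQ //.
    by rewrite /edge /= i02.
  + by apply: HT; rewrite -nT.
  + have ni : i != k by rewrite -nK.
    rewrite -(HT i ni); apply: lk; rewrite ?nT ?nK //.
    by rewrite /edge /= eqxx.
  + by apply: HQ; rewrite -nQ.
- exists (vQ (@Ordinal 5 0 isT)).
  have HQ i : D (vQ i) <-> D (vQ (@Ordinal 5 0 isT)).
    split; apply: (@cycle5 (D \o vQ)) => {}i; apply: iffLR; apply: lk; rewrite ?starE //=;
    by rewrite /edge /= eqxx.
  have HT i : i != k -> D (vT i) <-> D (vQ (@Ordinal 5 0 isT)).
    move=> ni; rewrite -(HQ i); apply: lk; rewrite ?starE //=.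
    by rewrite /edge /= eqxx.
  have HR w : D (vR w) <-> D (vQ (@Ordinal 5 0 isT)).
    by apply: lk; rewrite ?starE.
  case=> [[w|w]|[[i|i]|i]] nz.
  + by rewrite -(HR w); apply: lk; rewrite ?starE // /edge /= eqxx.
  + exact: HR.
  + by apply: HT; move: nz; rewrite starE /=.
  + have ni : i != k by move: nz; rewrite starE /= negb_or => /andP[].
    by rewrite -(HT i ni); apply: lk => //; rewrite ?starE // /edge /= eqxx ?orbT.
  + exact: HQ.
- exists (vK (@Ordinal 5 0 isT)).
  have HK i : D (vK i) <-> D (vK (@Ordinal 5 0 isT)).
    split; apply: (@cycle5 (D \o vK)) => {}i; apply: iffLR; apply: lk; rewrite ?starE //=;
    by rewrite /edge /= eqxx.
  have HT i : i != k -> D (vT i) <-> D (vK (@Ordinal 5 0 isT)).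
    move=> ni; rewrite -(HK i); apply: lk; rewrite ?starE //=.
    by rewrite /edge /= eqxx.
  have HV w : D (vV w) <-> D (vK (@Ordinal 5 0 isT)).
    rewrite -(HT _ (ordS_neq k)); apply: lk; rewrite ?starE //=.
    exact: ordS_neq.
  case=> [[w|w]|[[i|i]|i]] nz.
  + exact: HV.
  + by rewrite -(HV w); apply: lk; rewrite ?starE // /edge /= eqxx.
  + by apply: HT; move: nz; rewrite starE /=.
  + exact: HK.
  + have ni : i != k by move: nz; rewrite starE /= negb_or => /andP[].
    by rewrite -(HT i ni); apply: lk => //; rewrite ?starE // /edge /= eqxx.
Qed.

End Connectivity.

(** * Pairs of stars do not cover the two vertex sets *)

Lemma avoid_T u : ~~ isV u -> exists i, forall j, j != i -> ~~ star edge u (vT j).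
Proof.
case: u => [[v|v]|[[i|i]|i]] // _.
- by exists ord0 => j _; rewrite starE.
- by exists i => j nj; rewrite starE /= !orbF.
- by exists i => j nj; rewrite starE /=.
- by exists i => j nj; rewrite starE /=.
Qed.

Lemma avoid_Q u : exists j, ~~ star edge u (vQ j).
Proof.
case: u => [[v|v]|[[i|i]|i]].
- by exists ord0; rewrite starE.
- by exists (@Ordinal 5 1 isT); rewrite starE.
- by exists (ordS i); rewrite starE /= orbF eq_sym; apply: ordS_neq.
- by exists ord0; rewrite starE.
- by exists (ordS (ordS i)); rewrite starE /=; ord_cases i.
Qed.

Lemma avoid_K u : exists j, ~~ star edge u (vK j).
Proof.
case: u => [[v|v]|[[i|i]|i]].
- by exists ord0; rewrite starE.
- by exists ord0; rewrite starE.
- by exists (ordS i); rewrite starE /= orbF eq_sym; apply: ordS_neq.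
- by exists (ordS (ordS i)); rewrite starE /=; ord_cases i.
- by exists ord0; rewrite starE.
Qed.

Lemma avoid_TT u u' : ~~ isV u -> ~~ isV u' ->
  exists j, ~~ star edge u (vT j) /\ ~~ star edge u' (vT j).
Proof.
move=> /avoid_T[i hi] /avoid_T[i' hi'].
have [j [ji ji']] : exists j : 'I_5, j != i /\ j != i'.
  clear hi hi'; ord_cases i; ord_cases i';
  first [by exists (@Ordinal 5 0 isT)|by exists (@Ordinal 5 1 isT)
        |by exists (@Ordinal 5 2 isT)].
by exists j; split; [apply: hi|apply: hi'].
Qed.

(** The star of a [vV v] contains no [vQ j], and any other star contains at most one of the five
    [vT j]. *)
Lemma cover_notK u u' : exists x, [/\ ~~ isK x, ~~ star edge u x & ~~ star edge u' x].
Proof.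
case: (boolP (isV u)) => [|nu].
  case: u => [[v|]|] // _; have [j hj] := avoid_Q u'.
  by exists (vQ j); split=> //; rewrite starE.
case: (boolP (isV u')) => [|nu'].
  case: u' => [[v|]|] // _; have [j hj] := avoid_Q u.
  by exists (vQ j); split=> //; rewrite starE.
by have [j [? ?]] := avoid_TT nu nu'; exists (vT j).
Qed.

Lemma cover_KT u u' : exists x, [/\ isKT x, ~~ star edge u x & ~~ star edge u' x].
Proof.
case: (boolP (isV u)) => [|nu].
  case: u => [[v|]|] // _; have [j hj] := avoid_K u'.
  by exists (vK j); split=> //; rewrite starE.
case: (boolP (isV u')) => [|nu'].
  case: u' => [[v|]|] // _; have [j hj] := avoid_K u.
  by exists (vK j); split=> //; rewrite starE.
by have [j [? ?]] := avoid_TT nu nu'; exists (vT j).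
Qed.

Lemma connected_notK u (D : vert -> Prop) : propagates u D -> forall x y,
  ~~ isK x -> ~~ isK y -> ~~ star edge u x -> ~~ star edge u y -> D x -> D y.
Proof.
move=> hD x y nx ny ux uy; case: (boolP (isV u)) => hu.
  exact: (connected_VRQ hD).
exact: (connected_all hD).
Qed.

Lemma connected_KT u (D : vert -> Prop) : propagates u D -> forall x y,
  isKT x -> isKT y -> ~~ star edge u x -> ~~ star edge u y -> D x -> D y.
Proof.
move=> hD x y nx ny ux uy; case: (boolP (isV u)) => hu; last exact: (connected_all hD).
case: u hu hD ux uy => [[v|]|] // _ hD.
case: x nx => [|[[i|i]|]] // _; rewrite starE //= => _.
case: y ny => [|[[j|j]|]] // _; rewrite starE //= => _.
exact: (connected_K hD).
Qed.

(** * The isomorphism *)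

Definition iota (w : word V) : word vert := [seq (vV l.1, l.2) | l <- w].

Lemma iota_cat w w' : iota (w ++ w') = iota w ++ iota w'.
Proof. exact: map_cat. Qed.

Lemma iota_eq w w' : raag_eq e w w' -> raag_eq edge (iota w) (iota w').
Proof.
move=> h; apply: raag_eq_homo h => _ _ [p q v b|p q v1 b1 v2 b2 h]; rewrite !iota_cat.
  by apply: rst_step; apply: step_free.
by apply: rst_step; apply: step_comm; rewrite edgeVV.
Qed.

Definition retr (w : word vert) : word V :=
  pmap (fun l => if l.1 is inl (inl v) then Some (v, l.2) else None) w.

Lemma retrK : cancel iota retr.
Proof. by elim=> //= -[v b] w IH; rewrite /retr /= -/(retr _) IH. Qed.

Lemma iotaK (w : word vert) : all (fun l => isV l.1) w -> iota (retr w) = w.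
Proof.
elim: w => //= -[[[v|//]|//] b] w IH /andP[/= _ /IH h].
by rewrite /retr /= -/(retr _) h.
Qed.

Lemma retr_eq w w' : raag_eq edge w w' -> raag_eq e (retr w) (retr w').
Proof.
move=> h; apply: raag_eq_homo h => _ _ [p q v b|p q v1 b1 v2 b2 h]; rewrite /retr !pmap_cat.
  case: v => [[v|v]|v] //=; apply: rst_step; exact: step_free.
case: v1 h => [[v1|v1]|v1] //=; case: v2 => [[v2|v2]|v2] //=; rewrite edgeVV => h.
by apply: rst_step; apply: step_comm.
Qed.

Lemma iota_isV w : inS edge isV (iota w).
Proof. by apply: all_inS; rewrite /iota all_map; elim: w. Qed.

Definition Phi (w : word V) (x : vert) : word vert :=
  if isK x then conj_by (iota w) (gen x) else gen x.

Lemma subst_Phi_iota w w' : subst (Phi w) (iota w') = iota w'.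
Proof.
elim: w' => // -[v b] w' IH; rewrite -[_ :: w']cat1s iota_cat subst_cat IH.
by congr (_ ++ _); case: b.
Qed.

Lemma Phi_cat w w' x : Phi (w ++ w') x = aut_comp (Phi w) (Phi w') x.
Proof.
rewrite /aut_comp {1 3}/Phi; case: ifP => h; last by rewrite subst_gen /Phi h.
by rewrite subst_conj subst_Phi_iota subst_gen /Phi h iota_cat conj_by_cat.
Qed.

Lemma Phi_nil x : Phi [::] x = gen x.
Proof. by rewrite /Phi /conj_by cats0; case: isK. Qed.

Lemma Phi_eq w w' x : raag_eq e w w' -> raag_eq edge (Phi w x) (Phi w' x).
Proof. by move=> /iota_eq h; rewrite /Phi; case: isK; rewrite // h. Qed.

(** Each [vT i] commutes with [iota w], so [Phi w] is a single conjugation on K and T together,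
    which contain every edge meeting K. *)
Lemma Phi_KT w x : isKT x -> raag_eq edge (Phi w x) (conj_by (iota w) (gen x)).
Proof.
rewrite /Phi; case: x => [|[[i|i]|]] //= _.
have h : inS edge (star edge (vT i)) (iota w).
  apply: all_inS; rewrite /iota all_map; apply/allP => l _ /=.
  by rewrite starE.
by rewrite /conj_by (star_commute h) invw_catK.
Qed.

Lemma edge_KT x y : edge x y -> isK x || isK y -> isKT x && isKT y.
Proof. by case: x => [[?|?]|[[?|?]|?]]; case: y => [[?|?]|[[?|?]|?]]. Qed.

Lemma Phi_endo w : is_endo edge (Phi w).
Proof.
move=> x y exy; have egen := (gen_auto edge).1 x y exy.
case: (boolP (isK x || isK y)) => [/(edge_KT exy)/andP[hx hy]|].
  by rewrite !Phi_KT // -!conj_byM egen.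
by rewrite negb_or /Phi => /andP[/negPf -> /negPf ->].
Qed.

Lemma Phi_PSA w : is_PSA edge (Phi w).
Proof.
split; last first.
  move=> x; rewrite /Phi; case: isK; first by exists (iota w).
  by exists [::]; rewrite /conj_by cats0.
split; first exact: Phi_endo.
exists (Phi (inv_word w)); split=> [|x]; first exact: Phi_endo.
rewrite -!/(aut_comp _ _ _) -!Phi_cat -(Phi_nil x).
by split; apply: Phi_eq; [exact: cat_invw|exact: invw_cat].
Qed.

(** The conjugator [c] centralizes every vertex outside K, and the stars of these have no common
    vertex, so [c] is trivial. Then the quotient of [iota w] and [iota w'] centralizes [vK 0], whose
    star contains no [vV v]. *)
Lemma Phi_inj w w' : out_eq edge (Phi w) (Phi w') -> raag_eq e w w'.
Proof.
case=> c hc; rewrite -[w]retrK -[w']retrK; apply: retr_eq.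
have c1 : raag_eq edge c [::].
  apply: (inS_nil edge_sym edge_irr) => x; have [y [nKy ny _]] := cover_notK x x.
  exists (star edge y); first by rewrite star_sym //; apply: edge_sym.
  apply: (commute_star edge_sym edge_irr).
  have /conj_by_eq : raag_eq edge (conj_by c (gen y)) (conj_by [::] (gen y)).
    by have := hc y; rewrite /Phi (negPf nKy) => <-; rewrite /conj_by cats0.
  by rewrite cats0.
have := hc (vK ord0); rewrite /Phi /= c1 {2}/conj_by cats0 /=.
move/conj_by_eq/(commute_star edge_sym edge_irr) => hK.
rewrite -[iota w]cats0 -(invw_cat edge (iota w')) catA.
suff -> : raag_eq edge (iota w ++ inv_word (iota w')) [::] by [].
apply: (inS_nil edge_sym edge_irr) => x; case: (boolP (isV x)) => hx.
  by exists (star edge (vK ord0)) => //; case: x hx => [[v|]|] // _; rewrite starE.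
by exists isV => //; apply: inS_cat; last apply: inS_inv; apply: iota_isV.
Qed.

Lemma Phi_surj g : is_PSA edge g -> exists w, out_eq edge (Phi w) g.
Proof.
move=> [[endo_g _] /fin_all_exists[b hb]].
have comm x y : edge x y ->
    raag_eq edge (conj_by (b x) (gen x) ++ conj_by (b y) (gen y))
                 (conj_by (b y) (gen y) ++ conj_by (b x) (gen x)).
  by move=> exy; rewrite -!hb; apply: endo_g.
have [p hp] := rigid edge_sym edge_irr connected_notK cover_notK comm.
have [p' hp'] := rigid edge_sym edge_irr connected_KT cover_KT comm.
have gconj x c : inS edge (star edge x) (b x ++ inv_word c) ->
    raag_eq edge (g x) (conj_by c (gen x)).
  by move=> h; rewrite hb; apply/conj_by_eq; apply: star_commute.
pose z := p' ++ inv_word p.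
have zT i : inS edge (star edge (vT i)) z.
  have := inS_cat (inS_inv (hp' (vT i) isT)) (hp (vT i) isT).
  by rewrite inv_word_cat inv_wordK -!catA invw_catK.
(* Only the [vV v] lie in the stars of both [vT 0] and [vT 1]. *)
have zV : all (fun l => isV l.1) (red edge z).
  apply/allP => l lz.
  have h i : star edge (vT i) l.1.
    exact: (allP (inS_red edge_sym edge_irr (zT i)) l lz).
  move: (h (@Ordinal 5 0 isT)) (h (@Ordinal 5 1 isT)); rewrite !starE.
  by case: (l.1) => [[?|?]|[[j|j]|j]] //=; ord_cases j.
(* After conjugation by [p^-1], [g] fixes the vertices outside K and conjugates those of K by
   [z]. *)
exists (retr (red edge z)), (inv_word p) => x.
rewrite /Phi; case: (boolP (isK x)) => hx; last first.
  by rewrite (gconj x p (hp x hx)) conj_byK.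
have hKT : isKT x by case: x hx => [|[]].
rewrite (iotaK zV) -(red_raag edge_sym edge_irr z).
by rewrite (gconj x p' (hp' x hKT)) -conj_by_cat.
Qed.

End Construction.

Theorem theorem3p1 (V : finType) (e : rel V) (esym : symmetric e)
    (eirr : irreflexive e) :
  exists (W : finType) (f : rel W), symmetric f /\ irreflexive f /\
    (* (1) A_e is isomorphic to PSO(A_f), via Phi (classes in Out represented
       by pure symmetric automorphisms) *)
    (exists Phi : word V -> (W -> word W),
       (forall w, is_PSA f (Phi w)) /\
       (forall w1 w2, raag_eq e w1 w2 <-> out_eq f (Phi w1) (Phi w2)) /\
       (forall w1 w2, out_eq f (Phi (w1 ++ w2)) (aut_comp (Phi w1) (Phi w2))) /\
       (forall g, is_PSA f g -> exists w, out_eq f (Phi w) g)) /\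
    (* (2) PSO(A_f) has finite index in Out(A_f): finitely many cosets *)
    (exists (n : nat) (L : 'I_n -> W -> word W),
       (forall i, is_auto f (L i)) /\
       forall g, is_auto f g ->
         exists i p, is_PSA f p /\ out_eq f g (aut_comp (L i) p)).
Proof.
exists (vert V), (edge e); have fsym := edge_sym e; have firr := edge_irr eirr.
split=> //; split=> //; split; last first.
  by apply: PSA_finite_index => //; apply: undominated_edge.
exists (@Phi V); split; first by move=> w; apply: Phi_PSA.
split; [|split]; last by move=> g; apply: Phi_surj.
  move=> w1 w2; split; last exact: Phi_inj.
  by move=> h; exists [::] => x; rewrite /conj_by cats0; apply: Phi_eq.
by move=> w1 w2; exists [::] => x; rewrite /conj_by cats0 Phi_cat.
Qed.
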